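(* Assume $V=L$. Let $\kappa$ be an uncountable cardinal, let $\delta$ be an ordinal, and suppose that $\langle A_\alpha : \alpha<\delta\rangle$ is a continuous ascending chain of subgroups of $\mathbb{Z}^\kappa$ such that for all $\alpha<\delta$: (1) $A_\alpha$ is not isomorphic to $\mathbb{Z}^\kappa$; and (2) $\mathbb{Z}^\kappa/A_\alpha$ is a product. Then $\mathbb{Z}^\kappa \neq \bigcup_{\alpha<\delta} A_\alpha$.
   Context: All groups are abelian. $V=L$ is Gödel's axiom of constructibility. $\mathbb{Z}^\kappa$ is the direct product of $\kappa$ copies of $\mathbb{Z}$. A group is called a product if it is isomorphic to $\mathbb{Z}^\lambda$ for some cardinal $\lambda$. A chain $\langle A_\alpha:\alpha<\delta\rangle$ is ascending if $A_\alpha\subseteq A_\beta$ for $\alpha\le\beta<\delta$, and continuous if $A_\xi=\bigcup_{\zeta<\xi}A_\zeta$ for every limit ordinal $\xi<\delta$. *)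

(* Defs.v *)
From HB Require Import structures.
From mathcomp Require Import all_boot all_algebra ring_quotient.
From mathcomp Require Import boolp classical_sets functions cardinality wochoice.

Set Implicit Arguments.
Unset Strict Implicit.
Unset Printing Implicit Defensive.

Import GRing.Theory.

(* One fixed universe of small types. The sets to which V = L refers are built
   from these types, and all cardinals and ordinals of the theorem are carried
   by them, so that V = L speaks about the universe in which the theorem lives. *)
Definition small := Type.

(** ** The cumulative hierarchy and the axiom V = L *)

(* Aczel's sets over [small]: [zmkset f] is {f a | a : A}. With the classical
   axioms used by MathComp-Analysis they form a model of ZFC, in which every
   small type is equinumerous with the elements of a set. *)
Inductive zset : Type := zmkset (A : small) of (A -> zset).

Definition zidx (x : zset) : small := let: @zmkset A _ := x in A.

Definition zelt (x : zset) : zidx x -> zset :=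
  let: zmkset _ f as y := x return zidx y -> zset in f.

Fixpoint zeq (x y : zset) : Prop :=
  let: zmkset A f := x in let: zmkset B g := y in
  (forall a, exists b, zeq (f a) (g b)) /\ (forall b, exists a, zeq (f a) (g b)).

Definition zin (x y : zset) : Prop := exists b : zidx y, zeq x (zelt b).

(* Formulas of the language of set theory; variables are de Bruijn indices. *)
Inductive formula : Set :=
| fIn (i j : nat)
| fEq (i j : nat)
| fNot (p : formula)
| fAnd (p q : formula)
| fEx (p : formula).

Definition zenv_cons (T : Type) (a : T) (e : nat -> T) (n : nat) : T :=
  if n is m.+1 then e m else a.

Fixpoint zsat (X : zset) (e : nat -> zidx X) (p : formula) : Prop :=
  match p with
  | fIn i j => zin (zelt (e i)) (zelt (e j))
  | fEq i j => zeq (zelt (e i)) (zelt (e j))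
  | fNot q => ~ zsat e q
  | fAnd q r => zsat e q /\ zsat e r
  | fEx q => exists a, zsat (zenv_cons a e) q
  end.

(* Def X = { {a in X | (X, in) |= p[a, s]} | p a formula, s a finite list of
   parameters from X }. Variable 0 denotes a, variable i.+1 the i-th parameter.
   Variables beyond the parameter list also denote a: this defines no further
   subsets, and it makes Def of the empty set equal to {empty set}. *)
Definition zDef (X : zset) : zset :=
  zmkset (fun ps : formula * seq (zidx X) =>
    zmkset (fun a : {a : zidx X | zsat (nth a (a :: ps.2)) ps.1} =>
      zelt (sval a))).

Definition zbigcup (A : small) (F : A -> zset) : zset :=
  zmkset (fun p : {a : A & zidx (F a)} => zelt (projT2 p)).

(* L_x = \bigcup_(y in x) Def(L_y); for ordinals x this is the usual hierarchy
   L_0 = 0, L_(y+1) = Def(L_y), L_x = \bigcup_(y < x) L_y for x limit. *)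
Fixpoint zL (x : zset) : zset :=
  let: zmkset A f := x in zbigcup (fun a => zDef (zL (f a))).

Definition ztransitive (x : zset) : Prop :=
  forall y z, zin z y -> zin y x -> zin z x.

(* Aczel's sets are well-founded, so this is von Neumann's notion. *)
Definition zordinal (x : zset) : Prop :=
  ztransitive x /\ (forall y, zin y x -> ztransitive y).

Definition V_eq_L : Prop :=
  forall x : zset, exists a : zset, zordinal a /\ zin x (zL a).

(** ** Abelian groups *)

Record subgroup (G : zmodType) (S : zmodClosed G) :=
  Subgroup { subgroup_val : G; _ : subgroup_val \in S }.

HB.instance Definition _ (G : zmodType) (S : zmodClosed G) :=
  [isSub for @subgroup_val G S].
HB.instance Definition _ (G : zmodType) (S : zmodClosed G) :=
  [Choice of subgroup S by <:].
HB.instance Definition _ (G : zmodType) (S : zmodClosed G) :=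
  [SubChoice_isSubZmodule of subgroup S by <:].

Definition isomorphic (G H : zmodType) : Prop :=
  exists f : {additive G -> H}, bijective f.

(* For the pointwise operations, [J -> int] is the direct product Z^J. *)
Definition is_product (G : zmodType) : Prop :=
  exists J : small, isomorphic G (J -> int).

(** ** Well-ordered index types *)

Definition strictly (D : Type) (R : rel D) (x y : D) : Prop := R x y /\ x <> y.

(* The least element is not a limit. *)
Definition is_limit (D : Type) (R : rel D) (x : D) : Prop :=
  (exists y, strictly R y x) /\
  (forall y, strictly R y x -> exists z, strictly R y z /\ strictly R z x).

Definition ascending (D T : Type) (R : rel D) (A : D -> set T) : Prop :=
  forall x y, R x y -> (A x `<=` A y)%classic.

Definition continuous_chain (D T : Type) (R : rel D) (A : D -> set T) : Prop :=
  forall x, is_limit R x -> A x = (\bigcup_(y in [set y | strictly R y x]) A y)%classic.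

(* Main.v *)
Require Import Defs.
From HB Require Import structures.
From Stdlib Require List.
From mathcomp Require Import all_boot all_algebra ring_quotient.
From mathcomp Require Import boolp classical_sets functions cardinality wochoice.

Set Implicit Arguments.
Unset Strict Implicit.
Unset Printing Implicit Defensive.

Import GRing.Theory Quotient.
Local Open Scope classical_set_scope.

(** V = L is used only through Scott's theorem that there are no measurable
cardinals. By Los and Specker every homomorphism Z^I -> Z then depends on finitely
many coordinates, so each A_a is the annihilator of the group B_a of functionals
that vanish on it, and the B_a decrease.

If the functionals of some B_a involve only countably many coordinates, Gaussian
elimination along these coordinates shows that A_a is isomorphic to Z^I.
Otherwise let kappa be least such that the coordinates of some B_a are covered by
kappa many finite sets. Suppose that the A_a cover Z^I. Then the intersection of
the B_a is 0, and as B_a has at most kappa elements, kappa many indices are cofinal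
in the chain. By minimality of kappa one can choose, in kappa steps, a functional
for each of these indices that involves a coordinate not used before, and then the
values of x at the new coordinates so that no chosen functional vanishes at x. This
x lies in no A_a.

Scott's theorem is proved with the ultrapower of the universe of Aczel sets: it
commutes with the hierarchy L, so V = L makes its collapse equal to the universe,
which contradicts the choice of the least ordinal that carries a countably complete
nonprincipal ultrafilter. *)

(** * Aczel sets *)

Lemma zeq_refl x : zeq x x.
Proof. by elim: x => A f IH /=; split=> a; exists a. Qed.

Lemma zeq_sym x y : zeq x y -> zeq y x.
Proof.
elim: x y => A f IH [B g] /= [h1 h2]; split.
- by move=> b; have [a /IH ?] := h2 b; exists a.
- by move=> a; have [b /IH ?] := h1 a; exists b.
Qed.

Lemma zeq_trans y x z : zeq x y -> zeq y z -> zeq x z.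
Proof.
elim: x y z => A f IH [B g] [C h] /= [h1 h2] [k1 k2]; split.
- by move=> a; have [b /IH ab] := h1 a; have [c bc] := k1 b; exists c; exact: ab.
- by move=> c; have [b bc] := k2 c; have [a /IH ab] := h2 b; exists a; exact: ab.
Qed.

Lemma zin_elt x (a : zidx x) : zin (zelt a) x.
Proof. by exists a; exact: zeq_refl. Qed.

Lemma zin_eql x x' y : zeq x x' -> zin x y -> zin x' y.
Proof. by move=> /zeq_sym e [b xb]; exists b; exact: zeq_trans xb. Qed.

Lemma zin_eqr x y y' : zeq y y' -> zin x y -> zin x y'.
Proof.
case: y y' => A f [B g] /= [h _] [/= a xa].
by have [b ab] := h a; exists b; exact: zeq_trans ab.
Qed.

Lemma zeq_ext x y : zeq x y <-> (forall z, zin z x <-> zin z y).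
Proof.
split=> [e z|]; first by split; apply: zin_eqr => //; exact: zeq_sym.
case: x y => A f [B g] /= h; split.
- move=> a; have /h [b ?] : zin (f a) (zmkset f) by exact: (zin_elt (x := zmkset f)).
  by exists b.
- move=> b; have /h [a ?] : zin (g b) (zmkset g) by exact: (zin_elt (x := zmkset g)).
  by exists a; exact: zeq_sym.
Qed.

(** Structural induction reaches only the listed branches of a set; proving [P] for every [y] that
    is [zeq] to [x] covers all members. *)
Lemma zin_ind (P : zset -> Prop) :
  (forall x, (forall y, zin y x -> P y) -> P x) -> forall x, P x.
Proof.
move=> ind x; suff H y : zeq x y -> P y by apply: H; exact: zeq_refl.
elim: x y => A f IH y e; apply: ind => z /(zin_eqr (zeq_sym e)) [a za].
exact: IH (zeq_sym za).
Qed.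

Lemma zin_irr x : ~ zin x x.
Proof. by elim/zin_ind: x => x IH xx; exact: (IH x xx xx). Qed.

Definition zempty : zset := zmkset (fun x : False => match x with end).

Definition zsep (X : zset) (Q : zidx X -> Prop) : zset :=
  zmkset (fun a : {a : zidx X | Q a} => zelt (sval a)).

Lemma zsepP X (Q : zidx X -> Prop) z :
  zin z (zsep Q) <-> exists a, Q a /\ zeq z (zelt a).
Proof.
split=> [[[a Qa] /= za]|[a [Qa za]]]; first by exists a.
by exists (exist _ a Qa).
Qed.

(** * Definability *)

(* [zsat] with arbitrary sets as values of the variables, hence invariant under [zeq]. *)
Fixpoint zholds (X : zset) (e : nat -> zset) (p : formula) : Prop :=
  match p with
  | fIn i j => zin (e i) (e j)
  | fEq i j => zeq (e i) (e j)
  | fNot q => ~ zholds X e q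
  | fAnd q r => zholds X e q /\ zholds X e r
  | fEx q => exists a, zin a X /\ zholds X (zenv_cons a e) q
  end.

Lemma zholds_congr X X' e e' p : zeq X X' -> (forall n, zeq (e n) (e' n)) ->
  zholds X e p <-> zholds X' e' p.
Proof.
elim: p X X' e e' => [i j|i j|p IH|p IHp q IHq|p IH] X X' e e' XX ee /=.
- split=> h; first exact: zin_eqr (ee j) (zin_eql (ee i) h).
  exact: zin_eqr (zeq_sym (ee j)) (zin_eql (zeq_sym (ee i)) h).
- split=> h; first exact: zeq_trans (zeq_sym (ee i)) (zeq_trans h (ee j)).
  exact: zeq_trans (ee i) (zeq_trans h (zeq_sym (ee j))).
- by have := IH _ _ _ _ XX ee; tauto.
- by have := IHp _ _ _ _ XX ee; have := IHq _ _ _ _ XX ee; tauto.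
- have H a : zholds X (zenv_cons a e) p <-> zholds X' (zenv_cons a e') p.
    by apply: IH => // -[|n] //=; exact: zeq_refl.
  by split=> -[a [aX ha]]; exists a; split; [exact: zin_eqr aX|apply/H|
    exact: zin_eqr (zeq_sym XX) aX|apply/H].
Qed.

Lemma zsat_holds X (e : nat -> zidx X) p :
  zsat e p <-> zholds X (fun n => zelt (e n)) p.
Proof.
elim: p e => [i j|i j|p IH|p IHp q IHq|p IH] e //=.
- by have := IH e; tauto.
- by have := IHp e; have := IHq e; tauto.
- have H a b : zeq b (zelt a) -> zsat (zenv_cons a e) p <->
      zholds X (zenv_cons b (fun n => zelt (e n))) p.
    move=> ba; rewrite IH; apply: zholds_congr => [|[|n]] //=; try exact: zeq_refl.
    exact: zeq_sym.
  split=> [[a /(H _ _ (zeq_refl _)) ha]|[b [[a ba] /(H _ _ ba) hb]]].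
    by exists (zelt a); split => //; exact: zin_elt.
  by exists a.
Qed.

(** With sets instead of indices as parameters, the condition no longer depends on how [X] is
    presented. *)
Lemma zDefP X y : zin y (zDef X) <-> exists p (s : seq zset),
  (forall i, i < size s -> zin (nth zempty s i) X) /\
  forall z, zin z y <-> zin z X /\ zholds X (nth z (z :: s)) p.
Proof.
split.
- move=> [[p s] /= ye]; exists p, (map (@zelt X) s); split=> [i|z].
    elim: s {ye} i => [//|a s IH] [|i] //= ilt; [exact: zin_elt|exact: IH].
  have H a : zeq z (zelt a) -> zsat (nth a (a :: s)) p <->
      zholds X (nth z (z :: map (@zelt X) s)) p.
    move=> za; rewrite zsat_holds; apply: zholds_congr => [|n]; first exact: zeq_refl.
    have [nlt|nge] := ltnP n (size (a :: s)).
      case: n nlt => [|n] nlt /=; first exact: zeq_sym.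
      by rewrite (nth_map a) //; exact: zeq_refl.
    rewrite nth_default// nth_default ?size_map//; first exact: zeq_sym.
    by rewrite /= size_map.
  move/zeq_ext: ye => ye; rewrite ye; split.
    move=> [[a ha] /= za]; split; first by exists a.
    by apply/(H a).
  by move=> [[a za] /(H _ za) ha]; exists (exist _ a ha).
- move=> [p [s [sX yP]]].
  have [s' [szs' s'P]] : exists s' : seq (zidx X), size s' = size s /\
      forall i a, i < size s -> zeq (nth zempty s i) (zelt (nth a s' i)).
    elim: s sX {yP} => [|x s IH] sX; first by exists [::].
    have [i|s' [szs' s'P]] := IH; first exact: (sX i.+1).
    have [a xa] := sX 0 isT; exists (a :: s'); split=> [|[|i] b ilt] //=.
      by rewrite szs'.
    exact: s'P.
  exists (p, s'); apply/zeq_ext => z.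
  have H a : zeq z (zelt a) -> zsat (nth a (a :: s')) p <-> zholds X (nth z (z :: s)) p.
    move=> za; rewrite zsat_holds; apply: zholds_congr => [|n]; first exact: zeq_refl.
    have [nlt|nge] := ltnP n (size (a :: s')).
      case: n nlt => [|n] nlt /=; first exact: zeq_sym.
      rewrite /= szs' ltnS in nlt; rewrite (set_nth_default zempty z) //.
      by apply: zeq_sym; exact: s'P.
    rewrite nth_default// nth_default; first exact: zeq_sym.
    by rewrite /= -szs'.
  rewrite yP; split.
    by move=> [[a za] /(H _ za) ha]; exists (exist _ a ha).
  move=> [[a ha] /= za]; split; first by exists a.
  by apply/(H a).
Qed.

Lemma zDef_congr X X' y : zeq X X' -> zin y (zDef X) -> zin y (zDef X').
Proof.
move=> XX /zDefP[p [s [sX yP]]]; apply/zDefP; exists p, s; split=> [i /sX|z].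
  exact: zin_eqr.
rewrite yP (zholds_congr (e' := nth z (z :: s)) p XX); last by move=> n; exact: zeq_refl.
by move/zeq_ext: XX => ->.
Qed.

Lemma zL_elim x y : zin y (zL x) <-> exists a : zidx x, zin y (zDef (zL (zelt a))).
Proof.
case: x => A f; split.
- by move=> [[a b] /= ye]; exists a; exists b.
- by move=> [a [b yb]]; exists (existT _ a b).
Qed.

Lemma zL_congr x x' : zeq x x' -> zeq (zL x) (zL x').
Proof.
elim: x x' => A f IH [B g] [h1 h2]; apply/zeq_ext => y; rewrite !zL_elim.
split=> -[a ya].
- by have [b ab] := h1 a; exists b; exact: zDef_congr (IH _ _ ab) ya.
- by have [b ab] := h2 a; exists b; exact: zDef_congr (zeq_sym (IH _ _ ab)) ya.
Qed.

Lemma zLP x y : zin y (zL x) <-> exists z, zin z x /\ zin y (zDef (zL z)).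
Proof.
rewrite zL_elim; split=> [[a ya]|[z [[a za] yz]]].
  by exists (zelt a); split; first exact: zin_elt.
by exists a; apply: zDef_congr yz; exact: zL_congr.
Qed.

(** * Ordinals *)

Lemma zordinal_in a b : zordinal a -> zin b a -> zordinal b.
Proof.
move=> [ta ea] ba; split; first exact: ea.
by move=> c cb; apply: ea; exact: ta cb ba.
Qed.

(** If some [c] in [a] is not in [b], induction compares [c] with [b], and both remaining cases put
    [b] into [a]; symmetrically for [b]. Otherwise [a] and [b] have the same members. *)
Lemma zordinal_trichotomy a b : zordinal a -> zordinal b ->
  zin a b \/ zeq a b \/ zin b a.
Proof.
elim/zin_ind: a b => a IHa; elim/zin_ind => b IHb oa ob.
have [[c [ca cb]]|nca] := pselect (exists c, zin c a /\ ~ zin c b).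
  have [|[cb'|bc]] := IHa c ca b (zordinal_in oa ca) ob; first by [].
    by right; right; apply: zin_eql ca.
  by right; right; exact: (oa.1 c b bc ca).
have [[c [cb ca]]|ncb] := pselect (exists c, zin c b /\ ~ zin c a).
  have [|[ac|]] := IHb c cb oa (zordinal_in ob cb);
    [|by left; apply: zin_eql (zeq_sym ac) cb|by []].
  by left; exact: (ob.1 c a _ cb).
right; left; apply/zeq_ext => c; split=> h; apply: contrapT => k.
  by apply: nca; exists c.
by apply: ncb; exists c.
Qed.

(** * Countably complete ultrafilters *)

(** Upward closure and binary intersections both follow from [ccu_bigcap]. Principal ultrafilters
    are included. *)
Record ccu (T : Type) (U : (T -> Prop) -> Prop) : Prop := CCU {
  ccu_or : forall A B : T -> Prop, (forall t, A t \/ B t) -> U A \/ U B;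
  ccu_false : ~ U (fun=> False);
  ccu_bigcap : forall (F : nat -> T -> Prop) (B : T -> Prop),
    (forall n, U (F n)) -> (forall t, (forall n, F n t) -> B t) -> U B }.

Section Ultrafilter.
Context {T : small} {U : (T -> Prop) -> Prop} (hU : ccu U).

Lemma ae_mono (A B : T -> Prop) : (forall t, A t -> B t) -> U A -> U B.
Proof. by move=> AB UA; apply: (ccu_bigcap hU (F := fun=> A)) => // t /(_ 0)/AB. Qed.

Lemma ae_and (A B : T -> Prop) : U A -> U B -> U (fun t => A t /\ B t).
Proof.
move=> UA UB; apply: (ccu_bigcap hU (F := fun n => if n is 0 then A else B)).
  by case.
by move=> t AB; split; [exact: (AB 0)|exact: (AB 1)].
Qed.

Lemma ae_all (A : T -> Prop) : (forall t, A t) -> U A.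
Proof.
move=> hA; have [//|h] := ccu_or hU (A := A) (B := fun=> False) (fun t => or_introl (hA t)).
by case: (ccu_false hU).
Qed.

Lemma ae_ex (A : T -> Prop) : U A -> exists t, A t.
Proof.
move=> UA; apply: contrapT => nA; apply: (ccu_false hU).
by apply: ae_mono UA => t At; apply: nA; exists t.
Qed.

Lemma ae_not (A : T -> Prop) : U (fun t => ~ A t) <-> ~ U A.
Proof.
split=> [h UA|nUA]; first by have [t []] := ae_ex (ae_and h UA).
by have [//|//] := ccu_or hU (A := A) (B := fun t => ~ A t) (fun t => EM (A t)).
Qed.

Lemma ae_imp (A B : T -> Prop) : (U A -> U B) -> U (fun t => A t -> B t).
Proof.
move=> AB; have [/AB|/ae_not] := EM (U A); first by apply: ae_mono => t ? _.
by apply: ae_mono => t nA /nA.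
Qed.

Lemma ae_mp (A B : T -> Prop) : U (fun t => A t -> B t) -> U A -> U B.
Proof. by move=> AB UA; apply: ae_mono (ae_and AB UA) => t [h /h]. Qed.

Lemma ae_choose (K : Type) (k0 : K) (Q : T -> K -> Prop) :
  U (fun t => exists k, Q t k) -> exists g : T -> K, U (fun t => Q t (g t)).
Proof.
have [g gP] : {g : T -> K & forall t, (exists k, Q t k) -> Q t (g t)}.
  apply: (choice (P := fun t k => (exists k, Q t k) -> Q t k)) => t.
  by have [[k Qk]|nQ] := EM (exists k, Q t k); [exists k|exists k0 => /nQ].
by move=> h; exists g; exact: ae_mono gP h.
Qed.

(** Otherwise counterexamples on a set of [U] would glue to a single function [g]. This is how
    quantifiers over sets are moved inside [U]. *)
Lemma ae_forall (K : Type) (Q : T -> K -> Prop) :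
  (forall g : T -> K, U (fun t => Q t (g t))) -> U (fun t => forall k, Q t k).
Proof.
move=> h; apply: contrapT => /ae_not n.
have [t /existsNP[k0 _]] := ae_ex n.
have [|g gP] := ae_choose k0 (Q := fun t k => ~ Q t k).
  by apply: ae_mono n => t' /existsNP.
by move/ae_not: gP; apply; exact: h.
Qed.

Lemma ae_bigcap (F : nat -> T -> Prop) :
  (forall n, U (F n)) -> U (fun t => forall n, F n t).
Proof. by move=> UF; exact: (ccu_bigcap hU UF). Qed.

(** Otherwise each of the countably many values is avoided almost everywhere, hence all of them at
    once at some [t]. *)
Lemma ae_const (K : countType) (g : T -> K) : exists k, U (fun t => g t = k).
Proof.
apply: contrapT => nk.
have [t tP] : exists t, forall n, pickle (g t) <> n.
  apply: ae_ex; apply: ae_bigcap => n; apply/ae_not => h; apply: nk.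
  have [t0 t0n] := ae_ex h; exists (g t0); apply: ae_mono h => t tn.
  by apply: (pcan_inj (@pickleK K)); rewrite tn t0n.
by case: (tP (pickle (g t))).
Qed.

End Ultrafilter.

(** * The ultrapower of the universe *)

(* [x] is the Mostowski collapse of the class of [f] modulo [U]. *)
Fixpoint collapses (T : small) (U : (T -> Prop) -> Prop) (f : T -> zset) (x : zset)
    : Prop :=
  let: zmkset B g := x in
  (forall h, U (fun t => zin (h t) (f t)) -> exists b, collapses U h (g b)) /\
  (forall b, exists h, U (fun t => zin (h t) (f t)) /\ collapses U h (g b)).

Section Ultrapower.
Context {T : small} {U : (T -> Prop) -> Prop} (hU : ccu U).
Implicit Types (f g h : T -> zset).

Lemma collapses_eq x y f g : collapses U f x -> collapses U g y ->
  U (fun t => zeq (f t) (g t)) -> zeq x y.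
Proof.
elim: x y f g => A a IH [B b] f g [f1 f2] [g1 g2] fg; split.
- move=> i; have [h [hf hi]] := f2 i.
  have [|j hj] := g1 h; last first.
    by exists j; apply: (IH i) hi hj _; apply: ae_all => // t; exact: zeq_refl.
  by apply: ae_mono (ae_and hU fg hf) => // t [fgt]; exact: zin_eqr.
- move=> j; have [h [hg hj]] := g2 j.
  have [|i hi] := f1 h; last first.
    by exists i; apply: (IH i) hi hj _; apply: ae_all => // t; exact: zeq_refl.
  by apply: ae_mono (ae_and hU fg hg) => // t [/zeq_sym fgt]; exact: zin_eqr.
Qed.

(** Extensionality modulo [U]: members of [f] are matched with members of [g] through their equal
    collapses. *)
Lemma collapses_inj x y f g : collapses U f x -> collapses U g y ->
  zeq x y -> U (fun t => zeq (f t) (g t)).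
Proof.
elim: x y f g => A a IH [B b] f g [f1 f2] [g1 g2] [xy yx].
have {}IH := fun i j h k H1 H2 H3 => IH i (b j) h k H1 H2 H3.
suff [fg gf] : U (fun t => forall z, zin z (f t) -> zin z (g t)) /\
               U (fun t => forall z, zin z (g t) -> zin z (f t)).
  apply: ae_mono (ae_and hU fg gf) => // t [h1 h2].
  by apply/zeq_ext => z; split; [exact: h1|exact: h2].
split; apply: ae_forall => // h; apply: ae_imp => // hf.
- have [i hi] := f1 _ hf; have [j ij] := xy i; have [k [kg kj]] := g2 j.
  have hk := IH _ _ _ _ hi kj ij.
  by apply: ae_mono (ae_and hU hk kg) => // t [/zeq_sym]; exact: zin_eql.
- have [j hj] := g1 _ hf; have [i ij] := yx j; have [k [kf ki]] := f2 i.
  have hk := IH _ _ _ _ ki hj ij.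
  by apply: ae_mono (ae_and hU hk kf) => // t []; exact: zin_eql.
Qed.

(** Membership modulo [U] is set-like, which gives [step], and well-founded by countable
    completeness. *)
Lemma collapses_ex f : exists x, collapses U f x.
Proof.
have step g : (forall h, U (fun t => zin (h t) (g t)) -> exists x, collapses U h x) ->
    exists x, collapses U g x.
  move=> hg.
  (* These sections form a small type and represent, up to [U], every function that lies in [g]
     almost everywhere; [None] serves the exceptional points. *)
  pose ev (k : forall t, option (zidx (g t))) t :=
    if k t is Some a then zelt a else zempty.
  have [c cP] : {c : (forall t, option (zidx (g t))) -> zset & forall k,
      U (fun t => zin (ev k t) (g t)) -> collapses U (ev k) (c k)}.
    apply: (choice (P := fun k x => U (fun t => zin (ev k t) (g t)) -> collapses U (ev k) x)) => k.
    have [/hg[x ?]|n] := EM (U (fun t => zin (ev k t) (g t))); first by exists x.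
    by exists zempty => /n.
  exists (zmkset (fun k : {k | U (fun t => zin (ev k t) (g t))} => c (sval k))).
  split=> [h hgt|[k kP] /=]; last by exists (ev k); split => //; exact: cP.
  have [k kP] : exists k : forall t, option (zidx (g t)), forall t, zin (h t) (g t) ->
      zeq (ev k t) (h t).
    have K t : {k : option (zidx (g t)) | zin (h t) (g t) ->
        zeq (if k is Some a then zelt a else zempty) (h t)}.
      apply: cid; have [[a /zeq_sym ha]|n] := EM (zin (h t) (g t)); first by exists (Some a).
      by exists None => /n.
    by exists (fun t => sval (K t)) => t; exact: (svalP (K t)).
  have kg : U (fun t => zin (ev k t) (g t)).
    by apply: ae_mono hgt => // t ht; apply: zin_eql (ht); apply: zeq_sym; exact: kP.
  exists (exist _ k kg) => /=.
  have [x hx] := hg _ hgt.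
  have e : zeq (c k) x.
    apply: collapses_eq (cP _ kg) hx _; apply: ae_mono hgt => // t; exact: kP.
  have {}e : U (fun t => zeq (ev k t) (h t)) by apply: ae_mono hgt => // t; exact: kP.
  have := cP _ kg; case: (c k) => B b [b1 b2]; split.
    move=> h' h'h; apply: b1; apply: ae_mono (ae_and hU e h'h) => // t [/zeq_sym].
    exact: zin_eqr.
  move=> b'; have [h' [h'1 h'2]] := b2 b'; exists h'; split => //.
  by apply: ae_mono (ae_and hU e h'1) => // t []; exact: zin_eqr.
(* A function without collapse starts a sequence that descends modulo [U]; by countable completeness
   it descends at one single [t], which is impossible for sets. *)
apply: contrapT => nf.
pose bad := {f | ~ exists x, collapses U f x}.
have next (b : bad) : {b' : bad | U (fun t => zin (sval b' t) (sval b t))}.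
  apply: cid; case: b => g ng /=; apply: contrapT => nb; apply: ng; apply: step => h hg.
  by apply: contrapT => nh; apply: nb; exists (exist _ h nh).
pose F := fix F n : bad := if n is m.+1 then sval (next (F m)) else exist _ f nf.
have [t tP] : exists t, forall n, zin (sval (F n.+1) t) (sval (F n) t).
  by apply: (ae_ex hU); apply: ae_bigcap => // n; exact: (svalP (next (F n))).
suff H x n : zeq (sval (F n) t) x -> False by exact: (H _ 0 (zeq_refl _)).
elim/zin_ind: x n => x IH n e; apply: (IH (sval (F n.+1) t) _ n.+1 (zeq_refl _)).
exact: zin_eqr e (tP n).
Qed.

Definition ult f : zset := sval (cid (collapses_ex f)).

Lemma ult_eq f g : zeq (ult f) (ult g) <-> U (fun t => zeq (f t) (g t)).
Proof.
have fx := svalP (cid (collapses_ex f)); have gy := svalP (cid (collapses_ex g)).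
by split; [exact: collapses_inj fx gy|exact: collapses_eq fx gy].
Qed.

Lemma ult_surj f y : zin y (ult f) ->
  exists h, U (fun t => zin (h t) (f t)) /\ zeq y (ult h).
Proof.
rewrite /ult; have := svalP (cid (collapses_ex f)).
case: (sval _) => B b [b1 b2] [/= i yi]; have [h [hf hi]] := b2 i; exists h; split => //.
apply: zeq_trans yi _; apply: collapses_eq hi (svalP (cid (collapses_ex h))) _.
by apply: ae_all => // t; exact: zeq_refl.
Qed.

Lemma ult_in f g : zin (ult f) (ult g) <-> U (fun t => zin (f t) (g t)).
Proof.
split=> [/ult_surj[h [hg /ult_eq e]]|fg].
  by apply: ae_mono (ae_and hU e hg) => // t [/zeq_sym]; exact: zin_eql.
have e y : collapses U f y -> zeq (ult f) y.
  move=> fh; apply: collapses_eq (svalP (cid (collapses_ex f))) fh _.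
  by apply: ae_all => // t; exact: zeq_refl.
rewrite {2}/ult; have := svalP (cid (collapses_ex g)).
by case: (sval _) => B b [b1 _]; have [i /e ei] := b1 _ fg; exists i.
Qed.

Lemma ult_sub f g : (forall z, zin z (ult f) -> zin z (ult g)) <->
  U (fun t => forall z, zin z (f t) -> zin z (g t)).
Proof.
split=> [fg|fg z /ult_surj[h [hf zh]]].
  by apply: ae_forall => // h; apply: ae_imp => // /ult_in/fg/ult_in.
apply: zin_eql (zeq_sym zh) _; apply/ult_in; apply: ae_mono (ae_and hU fg hf) => // t [+ ht].
exact.
Qed.

(** Los's theorem, with quantifiers bounded by [X]; witnesses of an existential formula are glued by
    [ae_choose]. *)
Lemma ult_holds X (e : nat -> T -> zset) p :
  zholds (ult X) (fun n => ult (e n)) p <-> U (fun t => zholds (X t) (e^~ t) p).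
Proof.
elim: p e => [i j|i j|p IH|p IHp q IHq|p IH] e /=.
- exact: ult_in.
- exact: ult_eq.
- by rewrite ae_not// -IH.
- rewrite IHp IHq; split=> [[]|h]; first exact: ae_and.
  by split; apply: ae_mono h => // t [].
- have H a y : zeq y (ult a) -> zholds (ult X) (zenv_cons y (fun n => ult (e n))) p <->
      U (fun t => zholds (X t) (zenv_cons (a t) (e^~ t)) p).
    move=> ya; rewrite (zholds_congr (X' := ult X) (e' := fun n => ult (zenv_cons a e n))).
    + rewrite IH; split; apply: ae_mono => // t; apply (zholds_congr _ (zeq_refl _));
        by case=> [|n] /=; exact: zeq_refl.
    + exact: zeq_refl.
    + by case=> [|n] //=; exact: zeq_refl.
  split=> [[y [/ult_surj[a [aX ya]] hy]]|].
    move/(H _ _ ya) in hy.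
    by apply: ae_mono (ae_and hU aX hy) => // t ?; exists (a t).
  move=> /(ae_choose hU zempty)[a aP]; exists (ult a); split.
    by apply/ult_in; apply: ae_mono aP => // t [].
  by apply/(H _ _ (zeq_refl _)); apply: ae_mono aP => // t [].
Qed.

End Ultrapower.

(** Coding by trees makes [formula] countable, so that [ae_const] applies to formulas that vary with
    [t]. *)
Fixpoint formula_code (p : formula) : GenTree.tree nat :=
  match p with
  | fIn i j => GenTree.Node 0 [:: GenTree.Leaf i; GenTree.Leaf j]
  | fEq i j => GenTree.Node 1 [:: GenTree.Leaf i; GenTree.Leaf j]
  | fNot q => GenTree.Node 2 [:: formula_code q]
  | fAnd q r => GenTree.Node 3 [:: formula_code q; formula_code r]
  | fEx q => GenTree.Node 4 [:: formula_code q]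
  end.

Fixpoint formula_decode (u : GenTree.tree nat) : formula :=
  match u with
  | GenTree.Node 0 [:: GenTree.Leaf i; GenTree.Leaf j] => fIn i j
  | GenTree.Node 1 [:: GenTree.Leaf i; GenTree.Leaf j] => fEq i j
  | GenTree.Node 2 [:: v] => fNot (formula_decode v)
  | GenTree.Node 3 [:: v; w] => fAnd (formula_decode v) (formula_decode w)
  | GenTree.Node 4 [:: v] => fEx (formula_decode v)
  | _ => fIn 0 0
  end.

Lemma formula_codeK : cancel formula_code formula_decode.
Proof. by elim=> //= [p ->|p -> q ->|p ->]. Qed.

HB.instance Definition _ := Countable.copy formula (can_type formula_codeK).

(** * The ultrapower commutes with the hierarchy L *)

Section UltrapowerL.
Context {T : small} {U : (T -> Prop) -> Prop} (hU : ccu U).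
Implicit Types (f g h X : T -> zset).

(** Los's theorem, with the tested element as value of variable 0 and of all variables beyond the
    parameters; equal lengths make these the same variables on both sides. *)
Lemma ult_definable X h p (s : T -> seq zset) (s' : seq zset) :
  U (fun t => size (s t) = size s') ->
  (forall k, k < size s' ->
    zeq (nth zempty s' k) (ult hU (fun t => nth zempty (s t) k))) ->
  U (fun t => forall z, zin z (h t) <->
    zin z (X t) /\ zholds (X t) (nth z (z :: s t)) p) ->
  forall z, zin z (ult hU h) <->
    zin z (ult hU X) /\ zholds (ult hU X) (nth z (z :: s')) p.
Proof.
move=> szs s's hP.
have H a z : zeq z (ult hU a) -> zholds (ult hU X) (nth z (z :: s')) p <->
    U (fun t => zholds (X t) (nth (a t) (a t :: s t)) p).
  move=> za; rewrite (zholds_congr (X' := ult hU X)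
    (e' := fun n => ult hU (fun t => nth (a t) (a t :: s t) n))); first exact: ult_holds.
    exact: zeq_refl.
  case=> [|n] //=; have [nlt|nge] := ltnP n (size s').
    rewrite (set_nth_default zempty z) //; apply: zeq_trans (s's _ nlt) _; apply/ult_eq.
    apply: ae_mono szs => // t szt; rewrite (set_nth_default zempty (a t)) ?szt//.
    exact: zeq_refl.
  rewrite nth_default//; apply: zeq_trans za _; apply/ult_eq.
  by apply: ae_mono szs => // t szt; rewrite nth_default ?szt//; exact: zeq_refl.
move=> z; split=> [/ult_surj[a [ah za]]|[/ult_surj[a [aX za]] /(H _ _ za) ha]].
  have {}ah : U (fun t => zin (a t) (X t) /\ zholds (X t) (nth (a t) (a t :: s t)) p).
    by apply: ae_mono (ae_and hU hP ah) => // t [+ ht] => /(_ (a t))[+ _]; exact.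
  split; last by apply/(H _ _ za); apply: ae_mono ah => // t [].
  by apply: zin_eql (zeq_sym za) _; apply/ult_in; apply: ae_mono ah => // t [].
apply: zin_eql (zeq_sym za) _; apply/ult_in.
apply: ae_mono (ae_and hU hP (ae_and hU aX ha)) => // t [+ ht] => /(_ (a t))[_]; exact.
Qed.

(** The defining formula and the number of parameters vary with [t], but each takes countably many
    values and so is constant almost everywhere. The parameters then collapse one by one. *)
Lemma ult_zDef X : zeq (ult hU (fun t => zDef (X t))) (zDef (ult hU X)).
Proof.
apply/zeq_ext => y; split.
- move=> /ult_surj[h [hX yh]].
  have [|k kP] := ae_choose hU (K := (formula * seq zset)%type) (fIn 0 0, [::])
    (Q := fun t k => (forall i, i < size k.2 -> zin (nth zempty k.2 i) (X t)) /\
    forall z, zin z (h t) <-> zin z (X t) /\ zholds (X t) (nth z (z :: k.2)) k.1).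
    by apply: ae_mono hX => // t /zDefP[p [s ?]]; exists (p, s).
  have [p pP] := ae_const hU (fun t => (k t).1).
  have [n nP] := ae_const hU (fun t => size (k t).2).
  apply/zDefP; exists p, (mkseq (fun i => ult hU (fun t => nth zempty (k t).2 i)) n).
  rewrite size_mkseq; split=> [i iltn|z].
    rewrite nth_mkseq//; apply/ult_in; apply: ae_mono (ae_and hU nP kP) => // t [szt [+ _]].
    by apply; rewrite szt.
  move/zeq_ext: yh => ->; apply: (ult_definable (s := fun t => (k t).2)).
  + by rewrite size_mkseq.
  + by move=> i; rewrite size_mkseq => iltn; rewrite nth_mkseq//; exact: zeq_refl.
  + by apply: ae_mono (ae_and hU pP kP) => // t [<- []].
- move=> /zDefP[p [s [sX yP]]].
  have [g gP] : {g : nat -> T -> zset & forall k, k < size s ->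
      U (fun t => zin (g k t) (X t)) /\ zeq (nth zempty s k) (ult hU (g k))}.
    apply: (choice (P := fun k gk => k < size s -> U (fun t => zin (gk t) (X t)) /\
      zeq (nth zempty s k) (ult hU gk))) => k.
    have [klt|_] := boolP (k < size s); last by exists (fun=> zempty).
    by have [gk ?] := ult_surj (sX k klt); exists gk.
  pose st t := mkseq (g^~ t) (size s).
  pose h t := zsep (X := X t)
    (fun a => zholds (X t) (nth (zelt a) (zelt a :: st t)) p).
  have hE t z : zin z (h t) <-> zin z (X t) /\ zholds (X t) (nth z (z :: st t)) p.
    have H (a : zidx (X t)) : zeq z (zelt a) ->
        zholds (X t) (nth z (z :: st t)) p <->
        zholds (X t) (nth (zelt a) (zelt a :: st t)) p.
      move=> za; apply: zholds_congr; first exact: zeq_refl.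
      case=> [|n] //=; have [nlt|nge] := ltnP n (size (st t)).
        by rewrite (set_nth_default z) //; exact: zeq_refl.
      by rewrite !nth_default.
    rewrite zsepP; split=> [[a [ha za]]|[[a za] ha]].
      by split; [exists a|exact: (H a za).2 ha].
    by exists a; split => //; exact: (H a za).1 ha.
  have yh : zeq y (ult hU h).
    apply/zeq_ext => z; rewrite yP; apply: iff_sym.
    apply: (ult_definable (s := st)).
    + by apply: ae_all => // t; rewrite size_mkseq.
    + move=> k klt; apply: zeq_trans (gP k klt).2 _; apply/ult_eq; apply: ae_all => // t.
      by rewrite nth_mkseq//; exact: zeq_refl.
    + by apply: ae_all => // t; exact: hE.
  apply: zin_eql (zeq_sym yh) _; apply/ult_in.
  have sX' : U (fun t => forall k, k < size s -> zin (g k t) (X t)).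
    apply: ae_bigcap => // k; have [klt|_] := boolP (k < size s).
      by apply: ae_mono (gP k klt).1.
    exact: ae_all.
  apply: ae_mono sX' => // t sXt; apply/zDefP; exists p, (st t); split=> [k|]; last exact: hE.
  by rewrite size_mkseq => klt; rewrite nth_mkseq//; exact: sXt.
Qed.

Lemma ult_zL f : zeq (ult hU (fun t => zL (f t))) (zL (ult hU f)).
Proof.
move E : (ult hU f) => x; have {E} : zeq (ult hU f) x by rewrite E; exact: zeq_refl.
elim/zin_ind: x f => x IH f fx.
apply: zeq_trans (zL_congr fx); apply/zeq_ext => y; split.
- move=> /ult_surj[h [hL yh]].
  have [|z zP] := ae_choose hU zempty
    (Q := fun t z => zin z (f t) /\ zin (h t) (zDef (zL z))).
    by apply: ae_mono hL => // t /zLP.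
  have zf : zin (ult hU z) (ult hU f) by apply/ult_in; apply: ae_mono zP => // t [].
  apply/zLP; exists (ult hU z); split => //.
  apply: (zDef_congr (X := ult hU (fun t => zL (z t)))).
    exact: IH (zin_eqr fx zf) _ (zeq_refl _).
  apply: zin_eqr (ult_zDef _) _; apply: zin_eql (zeq_sym yh) _; apply/ult_in.
  by apply: ae_mono zP => // t [].
- move=> /zLP[u [uf yu]]; have [z [zf uz]] := ult_surj uf.
  have {yu} : zin y (ult hU (fun t => zDef (zL (z t)))).
    apply: zin_eqr (zeq_sym (ult_zDef _)) _; apply: zDef_congr yu.
    by apply: zeq_sym; apply: IH (zin_eqr fx uf) _ _; exact: zeq_sym.
  move=> /ult_surj[h [hz yh]]; apply: zin_eql (zeq_sym yh) _; apply/ult_in.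
  by apply: ae_mono (ae_and hU zf hz) => // t ?; apply/zLP; exists (z t).
Qed.

Lemma ult_ordinal f : U (fun t => zordinal (f t)) -> zordinal (ult hU f).
Proof.
have tr g : U (fun t => ztransitive (g t)) -> ztransitive (ult hU g).
  move=> gP y z zy /ult_surj[b [bg yb]]; have /ult_surj[c [cb zc]] := zin_eqr yb zy.
  apply: zin_eql (zeq_sym zc) _; apply/ult_in.
  by apply: ae_mono (ae_and hU gP (ae_and hU bg cb)) => // t [h [h1 h2]]; exact: h h2 h1.
move=> fP; split; first by apply: tr; apply: ae_mono fP => // t [].
move=> y /ult_surj[b [bf yb]].
have : ztransitive (ult hU b).
  by apply: tr; apply: ae_mono (ae_and hU fP bf) => // t [[_ h] /h].
by move=> h u v vu uy; apply: zin_eqr (zeq_sym yb) _; exact: h vu (zin_eqr yb uy).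
Qed.

(** Let j send [a] to [ult hU (fun=> a)]. If j moved an ordinal [a] down, j(a) would be a smaller
    ordinal that j moves down as well. *)
Lemma ult_const_ge a : zordinal a ->
  zin a (ult hU (fun=> a)) \/ zeq a (ult hU (fun=> a)).
Proof.
move=> oa; have oj b : zordinal b -> zordinal (ult hU (fun=> b)).
  by move=> ob; apply: ult_ordinal; exact: ae_all.
have [|[|ja]] := zordinal_trichotomy oa (oj _ oa); [by left|by right|exfalso].
elim/zin_ind: a oa ja => a IH oa ja.
apply: (IH _ ja (oj _ oa)); apply/ult_in; exact: ae_all.
Qed.

(** If [x] is in L_a, then a <= j(a) puts [x] into L_j(a) = j(L_a), whose members are all
    represented by functions. *)
Lemma ult_onto : V_eq_L -> forall x, exists f, zeq x (ult hU f).
Proof.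
move=> VL x; have [a [oa xa]] := VL x.
suff : zin x (ult hU (fun=> zL a)) by move=> /ult_surj[f [_ ?]]; exists f.
apply: zin_eqr (zeq_sym (ult_zL _)) _; move/zLP: xa => [z [za xz]]; apply/zLP.
exists z; split => //; have [aj|aj] := ult_const_ge oa; last exact: zin_eqr aj za.
have [tj _] : zordinal (ult hU (fun=> a)) by apply: ult_ordinal; exact: ae_all.
exact: tj za aj.
Qed.

End UltrapowerL.

(** * V = L refutes measurable cardinals *)

Definition zsub (x y : zset) : Prop := forall z, zin z x -> zin z y.

(* Nonprincipal ultrafilters are taken to be Aczel sets, so that the ultrapower
   can represent them. *)
Record zccu (w x : zset) : Prop := ZCCU {
  zccu_or : forall r s, zsub r x -> zsub s x ->
    (forall z, zin z x -> zin z r \/ zin z s) -> zin r w \/ zin s w;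
  zccu_two : forall s, zin s w ->
    exists z z', [/\ zin z s, zin z' s & ~ zeq z z'];
  zccu_bigcap : forall (s : nat -> zset) r, (forall n, zin (s n) w) -> zsub r x ->
    (forall z, zin z x -> (forall n, zin z (s n)) -> zin z r) -> zin r w }.

Definition measurable_set (x : zset) : Prop := exists w, zccu w x.

Lemma zccu_congr w w' x x' : zeq w w' -> zeq x x' -> zccu w x -> zccu w' x'.
Proof.
move=> /zeq_ext ww /zeq_ext xx [h1 h2 h3]; split.
- move=> r s rx sx h; rewrite -!ww; apply: h1 => z.
  + by rewrite xx; exact: rx.
  + by rewrite xx; exact: sx.
  + by rewrite xx; exact: h.
- by move=> s; rewrite -ww; exact: h2.
- move=> s r sw rx h; rewrite -ww; apply: (h3 s) => [n|z|z].
  + by rewrite ww.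
  + by rewrite xx; exact: rx.
  + by rewrite xx; exact: h.
Qed.

(** The witness is the image of [U] under [g]; it is nonprincipal because [g] is not almost
    constant. *)
Lemma measurable_setI (T : small) (U : (T -> Prop) -> Prop) (hU : ccu U)
    (g : T -> zset) (x : zset) :
  U (fun t => zin (g t) x) -> (forall z, ~ U (fun t => zeq (g t) z)) ->
  measurable_set x.
Proof.
move=> gx gz.
pose w := zmkset (fun A : {A : zidx x -> Prop | U (fun t => zin (g t) (zsep A))} =>
  zsep (sval A)).
have w1 s : zin s w -> U (fun t => zin (g t) s).
  by move=> [[A hA] /= sA]; apply: ae_mono hA => // t; apply: zin_eqr; exact: zeq_sym.
have w2 s : zsub s x -> U (fun t => zin (g t) s) -> zin s w.
  move=> sx gs; pose A (a : zidx x) := zin (zelt a) s.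
  have sA : zeq s (zsep A).
    apply/zeq_ext => z; rewrite zsepP; split=> [zs|[a [h /zeq_sym za]]].
      by have [a za] := sx _ zs; exists a; split => //; apply: zin_eql zs.
    exact: zin_eql za h.
  have hA : U (fun t => zin (g t) (zsep A)) by apply: ae_mono gs => // t; exact: zin_eqr.
  by exists (exist _ A hA).
exists w; split.
- move=> r s rx sx h.
  have [|gr|gs] := @ccu_or _ _ hU (fun t => zin (g t) x -> zin (g t) r)
    (fun t => zin (g t) s).
  + by move=> t; have [/h|] := EM (zin (g t) x); tauto.
  + by left; apply: w2 => //; exact: ae_mp gr gx.
  + by right; exact: w2.
- move=> s /w1 gs; have [t0 t0s] := ae_ex hU gs; apply: contrapT => n.
  apply: (gz (g t0)); apply: ae_mono gs => // t ts; apply: contrapT => ne.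
  by apply: n; exists (g t), (g t0).
- move=> s r sw rx h; apply: w2 => //.
  apply: ae_mono (ae_and hU gx (ae_bigcap hU (fun n => w1 _ (sw n)))) => // t [].
  exact: h.
Qed.

Lemma zidx_repr (x : zset) : exists rep : zidx x -> zidx x,
  (forall a, zeq (zelt (rep a)) (zelt a)) /\
  (forall a b : zidx x, zeq (zelt a) (zelt b) -> rep a = rep b).
Proof.
have ex (a : zidx x) : exists b : zidx x, zeq (zelt b) (zelt a) by exists a; exact: zeq_refl.
exists (fun a => sval (cid (ex a))); split=> [a|a b ab]; first exact: svalP (cid (ex a)).
have ab' : (fun c : zidx x => zeq (zelt c) (zelt a)) =
    (fun c => zeq (zelt c) (zelt b)).
  apply: funext => c; apply: propext; split=> h; apply: zeq_trans h _ => //.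
  exact: zeq_sym.
move: (ex a) (ex b); rewrite ab' => e e'.
by rewrite (Prop_irrelevance e e').
Qed.

Lemma measurable_set_ultrafilter (x : zset) : measurable_set x ->
  exists U : (zidx x -> Prop) -> Prop,
    ccu U /\ forall z, ~ U (fun a => zeq (zelt a) z).
Proof.
move=> [w [h1 h2 h3]]; have [rep [repz rep_eq]] := zidx_repr x.
have sepx (A : zidx x -> Prop) : zsub (zsep A) x.
  by move=> z /zsepP[a [_ za]]; exists a.
(* Without [rep], an element could belong to the separated sets of different [n] through different
   indices, and closure under intersections would fail. *)
exists (fun A => zin (zsep (fun a => A (rep a))) w); split; first split.
- move=> A B AB; apply: h1 => // z [a za].
  by case: (AB (rep a)) => ?; [left|right]; apply/zsepP; exists a.
- by move=> /h2[z [_ [zF _ _]]]; have /zsepP[a []] := zF.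
- move=> F B hF FB; apply: (h3 _ _ hF) => // z [a za] zF.
  apply/zsepP; exists a; split => //; apply: FB => n.
  have /zsepP[b [Fb zb]] := zF n.
  have -> : rep a = rep b by apply: rep_eq; apply: zeq_trans (zeq_sym za) zb.
  exact: Fb.
- move=> z /h2[u [v [uA vA]]]; apply.
  have /zsepP[a [az ua]] := uA; have /zsepP[b [bz vb]] := vA.
  apply: zeq_trans ua _; apply: zeq_trans (zeq_sym (repz a)) _; apply: zeq_trans az _.
  apply: zeq_sym; apply: zeq_trans vb _; apply: zeq_trans bz.
  exact: zeq_sym (repz b).
Qed.

Lemma ae_or (T : small) (U : (T -> Prop) -> Prop) (hU : ccu U) (A B : T -> Prop) :
  U (fun t => A t \/ B t) -> U A \/ U B.
Proof.
move=> UAB; have [UA|/(ae_not hU) nA] := EM (U A); first by left.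
by right; apply: ae_mono (ae_and hU UAB nA) => // t [[]].
Qed.

(** By V = L the ultrafilter on the collapse of [f] is itself represented by some [w], and each
    clause of [zccu] passes down to [w t] almost everywhere. *)
Lemma measurable_set_ult (VL : V_eq_L) (T : small) (U : (T -> Prop) -> Prop)
    (hU : ccu U) (f : T -> zset) :
  measurable_set (ult hU f) -> U (fun t => measurable_set (f t)).
Proof.
move=> [w0 hw0]; have [w /zccu_congr hw] := ult_onto hU VL w0.
have {hw0 hw} [h1 h2 h3] := hw _ _ (zeq_refl _) hw0.
have K1 : U (fun t => forall r s, zsub r (f t) -> zsub s (f t) ->
    (forall z, zin z (f t) -> zin z r \/ zin z s) -> zin r (w t) \/ zin s (w t)).
  apply: (ae_forall hU) => r; apply: (ae_forall hU) => s.
  apply: (ae_imp hU) => /(ult_sub hU) rf; apply: (ae_imp hU) => /(ult_sub hU) sf.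
  apply: (ae_imp hU) => rs.
  have [|/ult_in rw|/ult_in sw] := h1 _ _ rf sf.
  + move=> z /ult_surj[a [af za]].
    have : U (fun t => zin (a t) (r t) \/ zin (a t) (s t)).
      by apply: ae_mono (ae_and hU rs af) => // t []; exact.
    move=> /(ae_or hU)[] /(ult_in hU) az; [left|right]; exact: zin_eql (zeq_sym za) az.
  + by apply: ae_mono rw => // t; left.
  + by apply: ae_mono sw => // t; right.
have K2 : U (fun t => forall s, zin s (w t) ->
    exists z z', [/\ zin z s, zin z' s & ~ zeq z z']).
  apply: (ae_forall hU) => s; apply: (ae_imp hU) => /(ult_in hU)/h2[z [z' []]].
  move=> /ult_surj[a [as_ za]] /ult_surj[b [bs zb]] ne.
  have /(ae_not hU) ab : ~ U (fun t => zeq (a t) (b t)).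
    move=> /(ult_eq hU) ab; apply: ne; apply: zeq_trans za _; apply: zeq_trans ab _.
    exact: zeq_sym.
  by apply: ae_mono (ae_and hU as_ (ae_and hU bs ab)) => // t [? []]; exists (a t), (b t).
have K3 : U (fun t => forall (s : nat -> zset) r, (forall n, zin (s n) (w t)) ->
    zsub r (f t) -> (forall z, zin z (f t) -> (forall n, zin z (s n)) -> zin z r) ->
    zin r (w t)).
  apply: (ae_forall hU) => s; apply: (ae_forall hU) => r.
  apply: (ae_imp hU) => sw; apply: (ae_imp hU) => /(ult_sub hU) rf.
  apply: (ae_imp hU) => sr; apply/(ult_in hU).
  apply: (h3 (fun n => ult hU (s^~ n))) => // [n|z /ult_surj[a [af za]] zs].
    by apply/ult_in; apply: ae_mono sw => // t.
  apply: zin_eql (zeq_sym za) _; apply/ult_in.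
  have as_ : U (fun t => forall n, zin (a t) (s t n)).
    by apply: (ae_bigcap hU) => n; apply/(ult_in hU); exact: zin_eql (zs n).
  by apply: ae_mono (ae_and hU af (ae_and hU as_ sr)) => // t [a1 [a2 a3]]; exact: a3.
by apply: ae_mono (ae_and hU K1 (ae_and hU K2 K3)) => // t [? [? ?]]; exists (w t).
Qed.

Lemma V_eq_L_not_measurable_set (VL : V_eq_L) x : zordinal x -> ~ measurable_set x.
Proof.
elim/zin_ind: x => x IH ox mx; have [U [hU Uz]] := measurable_set_ultrafilter mx.
(* A function into [a] that is not almost constant would make [a] measurable, against the minimality
   of [x]. Hence j is the identity below [x]. *)
have fixed a : zin a x -> zeq (ult hU (fun=> a)) a.
  elim/zin_ind: a => a IHa ax.
  have IHb b : zin b a -> zeq (ult hU (fun=> b)) b.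
    by move=> ba; apply: IHa => //; exact: ox.1 ba ax.
  apply/zeq_ext => y; split=> [/ult_surj[h [ha yh]]|ya].
    have [b hb] : exists b, U (fun t => zeq (h t) b).
      apply: contrapT => nb; apply: (IH a ax (zordinal_in ox ax)).
      by apply: (measurable_setI hU ha) => z hz; apply: nb; exists z.
    have ba : zin b a.
      by have [t [+ ht]] := ae_ex hU (ae_and hU hb ha); move=> /zin_eql; exact.
    apply: zin_eql (ba); apply: zeq_sym; apply: zeq_trans yh _.
    by apply: zeq_trans (IHb _ ba); apply/ult_eq.
  by apply: zin_eql (IHb _ ya) _; apply/ult_in; exact: ae_all.
have [xj|xj] := ult_const_ge hU ox.
(* If [x] is in j(x), it is represented by some [f] that takes almost all values in [x], and almost
   all of these are measurable. *)
- have [f [fx xf]] := ult_surj xj.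
  have [w /zccu_congr hw] := mx.
  have /(measurable_set_ult VL) mf : measurable_set (ult hU f).
    by exists w; exact: hw (zeq_refl _) xf.
  have [t [ft mt]] := ae_ex hU (ae_and hU fx mf).
  exact: IH ft (zordinal_in ox ft) mt.
(* If j(x) = x, the identity represents some [i] in [x], which j fixes; so the identity is almost
   constant. *)
- pose i := ult hU (@zelt x).
  have ix : zin i x.
    apply: zin_eqr (zeq_sym xj) _; apply/ult_in; apply: ae_all => // t; exact: zin_elt.
  by apply: (Uz i); apply/(ult_eq hU (@zelt x) (fun=> i)); exact: zeq_sym (fixed _ ix).
Qed.

(** * Well-orders *)

Section WellOrder.
Context {T : Type} {R : rel T} (wo : well_order R).

Lemma wo_min (Q : T -> Prop) : (exists x, Q x) -> exists z, Q z /\ forall y, Q y -> R z y.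
Proof.
move=> [x Qx]; have [|z [[zQ zmin] _]] := wo (A := fun y => `[< Q y >]).
  by exists x; apply/asboolP.
by exists z; split=> [|y Qy]; [exact/asboolP|apply: zmin; apply/asboolP].
Qed.

(** [well_order] provides unique least elements of nonempty sets; the order axioms are read off from
    sets of at most three elements. *)
Lemma wo_refl x : R x x.
Proof. by have [|z [-> h]] := @wo_min (eq^~ x); [exists x|exact: h]. Qed.

Lemma wo_total x y : R x y \/ R y x.
Proof.
have [|z [[->|->] h]] := @wo_min (fun z => z = x \/ z = y); first by exists x; left.
  by left; apply: h; right.
by right; apply: h; left.
Qed.

Lemma wo_anti x y : R x y -> R y x -> x = y.
Proof.
move=> xy yx; have [|z [_ uz]] := wo (A := fun z => `[< z = x \/ z = y >]).
  by exists x; apply/asboolP; left.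
have mem w : w = x \/ w = y -> w \in (fun z => `[< z = x \/ z = y >]) by move/asboolP.
rewrite -(uz x) ?(uz y) //; split; try (by apply: mem; tauto);
  by move=> w /asboolP[] ->; rewrite ?wo_refl.
Qed.

Lemma wo_trans y x z : R x y -> R y z -> R x z.
Proof.
move=> xy yz; have [|w [[->|[->|->]] h]] := @wo_min (fun w => w = x \/ w = y \/ w = z).
- by exists x; left.
- by apply: h; tauto.
- by rewrite (wo_anti xy) //; apply: h; tauto.
- by rewrite -(wo_anti yz) //; apply: h; tauto.
Qed.

Lemma wo_lt_le x y : strictly R x y <-> ~ R y x.
Proof.
split=> [[xy ne] yx|nyx]; first exact: ne (wo_anti xy yx).
have [xy|//] := wo_total x y; split=> // e; apply: nyx; rewrite e; exact: wo_refl.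
Qed.

Lemma wo_lt_trans x y z : strictly R x y -> strictly R y z -> strictly R x z.
Proof.
move=> [xy _] /wo_lt_le yz; apply/wo_lt_le => zx; apply: yz; exact: wo_trans zx xy.
Qed.

Lemma wo_wf : well_founded (strictly R).
Proof.
move=> x; apply: contrapT => nx.
have [|z [nz zmin]] := @wo_min (fun z => ~ Acc (strictly R) z); first by exists x.
by apply: nz; constructor => y /wo_lt_le yz; apply: contrapT => /zmin.
Qed.

End WellOrder.

Lemma wf_recursion (T Y : Type) (lt : T -> T -> Prop) (y0 : Y) (F : T -> (T -> Y) -> Y) :
  well_founded lt ->
  exists g : T -> Y, forall x, g x = F x (fun y => if pselect (lt y x) then g y else y0).
Proof.
move=> wf; pose body x (rec : forall y, lt y x -> Y) :=
  F x (fun y => if pselect (lt y x) is left h then rec y h else y0).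
exists (Fix wf (fun=> Y) body) => x; rewrite Fix_eq.
  by congr F; apply: funext => y; case: pselect.
move=> {}x f g fg; congr F; apply: funext => y; by case: pselect.
Qed.

(* The default value [y0] makes [Q x] depend on [g] only below [x]. *)
Lemma wf_choice (T Y : Type) (lt : T -> T -> Prop) (y0 : Y) (Q : T -> (T -> Y) -> Y -> Prop) :
  well_founded lt ->
  (forall x h, exists y, Q x h y) ->
  exists g : T -> Y, forall x, Q x (fun y => if pselect (lt y x) then g y else y0) (g x).
Proof.
move=> wf ex; have [g gE] := wf_recursion y0 (fun x h => sval (cid (ex x h))) wf.
by exists g => x; rewrite gE; exact: svalP (cid (ex x _)).
Qed.

Lemma V_eq_L_ccu_principal (VL : V_eq_L) (T : small) (U : (T -> Prop) -> Prop) :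
  ccu U -> exists t, U (fun t' => t' = t).
Proof.
move=> hU; apply: contrapT => np.
have [R wo] := well_ordering_principle {classic T}.
pose lt : T -> T -> Prop := strictly R.
(* The Mostowski collapse of the well-order; its range is an ordinal, onto which [U] is
   transported. *)
have [r rE] := wf_recursion zempty
  (fun x h => zmkset (fun y : {y : T | lt y x} => h (sval y))) (wo_wf wo : well_founded lt).
have rP x z : zin z (r x) <-> exists y, lt y x /\ zeq z (r y).
  rewrite rE; split=> [[/= p]|[y [yx zy]]].
    by case: p => y yx /=; case: pselect => //= _; exists y.
  by exists (exist _ y yx) => /=; case: pselect.
have r_in x y : lt y x -> zin (r y) (r x).
  by move=> yx; apply/rP; exists y; split => //; exact: zeq_refl.
have r_inj x y : zeq (r x) (r y) -> x = y.
  move=> e; apply: contrapT => ne.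
  have [xy|yx] := wo_total wo x y.
    by apply: (@zin_irr (r y)); apply: zin_eql e _; exact: r_in.
  by apply: (@zin_irr (r y)); apply: zin_eqr e _; apply: r_in; split => // /esym.
have r_trans x : ztransitive (r x).
  move=> y z zy /rP[a [ax ya]]; have /rP[b [ba zb]] := zin_eqr ya zy.
  by apply/rP; exists b; split => //; exact: (wo_lt_trans wo) ba ax.
have ok : zordinal (zmkset r).
  split=> [y z zy [/= a ya]|y [/= a ya]].
    by have /rP[b [_ zb]] := zin_eqr ya zy; exists b.
  move=> u v vu uy; apply: zin_eqr (zeq_sym ya) _; exact: r_trans vu (zin_eqr ya uy).
apply: (V_eq_L_not_measurable_set VL ok); apply: (measurable_setI hU (g := r)).
  by apply: (ae_all hU) => t; exists t; exact: zeq_refl.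
move=> z rz; have [t tz] := ae_ex hU rz; apply: np; exists t.
by apply: (ae_mono hU) rz => t' t'z; apply: r_inj; apply: zeq_trans t'z _; exact: zeq_sym.
Qed.

(** * Functionals on products of copies of the integers *)

Local Open Scope quotient_scope.
Local Open Scope ring_scope.

Definition addf (I : Type) (phi : (I -> int) -> int) : Prop :=
  forall x y, phi (x + y) = phi x + phi y.

Definition unitv (I : Type) (i : I) : I -> int := fun j => if pselect (j = i) then 1 else 0.

Lemma unitv_eq (I : Type) (i : I) : unitv i i = 1.
Proof. by rewrite /unitv; case: pselect. Qed.

Lemma unitv_neq (I : Type) (i j : I) : j <> i -> unitv i j = 0.
Proof. by rewrite /unitv; case: pselect. Qed.

Section Additive.
Context {I : Type} {phi : (I -> int) -> int} (hphi : addf phi).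

Lemma addf0 : phi (fun=> 0) = 0.
Proof.
have := hphi (fun=> 0) (fun=> 0).
have -> : ((fun=> 0) + (fun=> 0) : I -> int) = fun=> 0.
  by apply: funext => i; exact: addr0.
by rewrite -[LHS]addr0 => /addrI /esym.
Qed.

Lemma addfE (x y z : I -> int) : (forall i, z i = x i + y i) -> phi z = phi x + phi y.
Proof. by move=> zxy; rewrite -hphi; congr phi; apply: funext. Qed.

Lemma addfM (c : int) x : phi (fun i => c * x i) = c * phi x.
Proof.
have H (n : nat) : phi (fun i => n%:Z * x i) = n%:Z * phi x.
  elim: n => [|n IH].
    rewrite mul0r -[RHS]addf0; congr phi; apply: funext => i; exact: mul0r.
  rewrite -addn1 PoszD mulrDl mul1r -IH; apply: addfE => i.
  by rewrite mulrDl mul1r.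
case: c => n //; rewrite NegzE mulNr -H; apply/eqP; rewrite -addr_eq0; apply/eqP.
by rewrite -(addfE (z := fun=> 0)) ?addf0// => i; rewrite mulNr addNr.
Qed.

End Additive.

(** With [J := nat] this pulls a functional on any product back to Z^N, where Specker's lemmas
    apply: [a] scales the part of [x] on each fibre of [r]. *)
Lemma addf_comp (I J : Type) (phi : (I -> int) -> int) (r : I -> J) (x : I -> int) :
  addf phi -> addf (fun a : J -> int => phi (fun i => a (r i) * x i)).
Proof. by move=> hphi a b; apply: (addfE hphi) => i; rewrite -mulrDl. Qed.

Lemma addf_tail (psi : (nat -> int) -> int) (a : nat -> int) n : addf psi ->
  psi a = \sum_(k < n) a k * psi (@unitv nat k) + psi (fun k => if (k < n)%N then 0 else a k).
Proof.
move=> hpsi; elim: n => [|n ->]; first by rewrite big_ord0 add0r.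
rewrite big_ord_recr /= -addrA; congr (_ + _); rewrite -(addfM hpsi).
apply: (addfE hpsi) => k; rewrite ltnS; case: ltngtP => [kn|nk|->].
- by rewrite unitv_neq ?mulr0 ?add0r// => e; rewrite e ltnn in kn.
- by rewrite unitv_neq ?mulr0 ?add0r// => e; rewrite e ltnn in nk.
- by rewrite unitv_eq mulr1 addr0.
Qed.

Lemma dvd_small (d : nat) (z y : int) : z = d%:Z * y -> (`|z| < d)%N -> z = 0.
Proof.
move=> -> ; rewrite abszM absz_nat; case: (posnP `|y|%N) => [/eqP|y0].
  by rewrite absz_eq0 => /eqP ->; rewrite mulr0.
by rewrite ltnNge leq_pmulr.
Qed.

(* Specker: evaluate on a vector whose entries [d n] divide each other and grow
   faster than the partial sums; its value then equals almost all of them. *)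
Lemma specker_finite (psi : (nat -> int) -> int) : addf psi ->
  exists n, forall m, (n <= m)%N -> psi (unitv m) = 0.
Proof.
move=> hpsi; pose c n := psi (unitv n).
(* [st n] is the pair of [d n] and the partial sum of [d k * c k] over k < n. The factor after [d m]
   ensures [dbig]. *)
pose st := fix st n : nat * int := if n is m.+1 then
  let S := (st m).2 + (st m).1%:Z * c m in (((st m).1 * (`|S| + m.+2))%N, S) else (1%N, 0).
pose d n := (st n).1; pose S n := (st n).2.
have dS n : d n.+1 = (d n * (`|S n.+1| + n.+2))%N by [].
have SS n : S n.+1 = S n + (d n)%:Z * c n by [].
have d0 n : (0 < d n)%N by elim: n => // n IH; rewrite dS muln_gt0 IH addn_gt0 orbT.
have dbig n : (`|S n| + n < d n)%N.
  case: n => [//|n]; rewrite dS; apply: leq_trans (leq_pmull _ (d0 n)).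
  by rewrite [leqRHS]addnS ltnS.
have ddvd n k : (n <= k)%N -> (d n %| d k)%N.
  elim: k => [|k IH]; first by rewrite leqn0 => /eqP ->.
  rewrite leq_eqVlt => /orP[/eqP -> //|]; rewrite ltnS => /IH h.
  by rewrite dS; exact: dvdn_mulr.
pose s := psi (fun k => (d k)%:Z).
(* The difference of [s] and [S n] is a multiple of [d n], yet smaller than [d n] in absolute
   value. *)
have sS n : (`|s| <= n)%N -> s = S n.
  move=> sn; apply/eqP; rewrite -subr_eq0; apply/eqP.
  have -> : S n = \sum_(k < n) (d k)%:Z * psi (@unitv nat k).
    by elim: n {sn} => [|n IH]; rewrite ?big_ord0// big_ord_recr /= SS IH.
  apply: (@dvd_small (d n) _ (psi (fun k => if (k < n)%N then 0 else (d k %/ d n)%N%:Z))).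
    rewrite {1}/s (addf_tail _ n hpsi) addrC addKr -(addfM hpsi); congr psi.
    apply: funext => k; case: ltnP => [_|nk]; first by rewrite mulr0.
    by rewrite -PoszM mulnC divnK// ddvd.
  have -> : \sum_(k < n) (d k)%:Z * psi (@unitv nat k) = S n.
    by elim: n {sn} => [|n IH]; rewrite ?big_ord0// big_ord_recr /= SS IH.
  apply: leq_ltn_trans (dbig n); apply: leq_trans (leqD_dist _ 0 _) _.
  by rewrite subr0 sub0r abszN addnC leq_add2l.
exists `|s|%N => m sm; have := sS m.+1 (leqW sm); rewrite SS -(sS m sm).
move=> /esym/eqP; rewrite -subr_eq0 addrC addKr mulf_eq0 => /orP[/eqP[e]|/eqP //].
by have := d0 m; rewrite e.
Qed.

(* Specker: write each entry as [2 ^ n * u + 3 ^ n * v]; both parts have values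
   divisible by arbitrarily high powers. *)
Lemma specker_zero (psi : (nat -> int) -> int) : addf psi ->
  (forall n, psi (unitv n) = 0) -> forall a, psi a = 0.
Proof.
move=> hpsi psi0 a.
have pow (p : nat) (u : nat -> int) : (1 < p)%N -> psi (fun n => (p ^ n)%N%:Z * u n) = 0.
  (* With this exponent, [z] is a multiple of [p ^ n], which exceeds its absolute value. *)
  move=> p1; set z := psi _; pose n := `|z|%N.
  apply: (@dvd_small (p ^ n) _ (psi (fun k => if (k < n)%N then 0 else (p ^ (k - n))%N%:Z * u k))).
    rewrite /z (addf_tail _ n hpsi) big1 ?add0r => [|k _]; last by rewrite psi0 mulr0.
    rewrite -(addfM hpsi); congr psi; apply: funext => k.
    case: ltnP => [_|nk]; first by rewrite mulr0.
    by rewrite mulrA -PoszM -expnD subnKC.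
  exact: ltn_expl.
have bez n : exists uv : int * int, a n = (2 ^ n)%N%:Z * uv.1 + (3 ^ n)%N%:Z * uv.2.
  have /coprimezP[[u v] /= uv] : coprimez (2 ^ n)%N%:Z (3 ^ n)%N%:Z.
    rewrite /coprimez /gcdz /=; apply/eqP; congr Posz; apply/eqP.
    exact: coprimeXl (coprimeXr _ _).
  by exists (a n * u, a n * v); rewrite /= !mulrA ![_%:Z * a n]mulrC -!mulrA -mulrDr
    [X in X + _]mulrC [X in _ + X]mulrC uv mulr1.
have {bez} [uv uvE] := choice bez.
rewrite (addfE hpsi (x := fun n => (2 ^ n)%N%:Z * (uv n).1)
  (y := fun n => (3 ^ n)%N%:Z * (uv n).2)) //.
by rewrite !pow// addr0.
Qed.

(** * Null sets and atoms of a functional *)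

Section Null.
Context {I : Type} {phi : (I -> int) -> int} (hphi : addf phi).

Definition null (S : I -> Prop) : Prop :=
  forall x : I -> int, (forall i, ~ S i -> x i = 0) -> phi x = 0.

Lemma null_sub (S S' : I -> Prop) : (forall i, S i -> S' i) -> null S' -> null S.
Proof. by move=> SS nS x xS; apply: nS => i S'i; apply: xS => /SS. Qed.

(** Otherwise vectors supported on the [F n] with nonzero values glue to one vector, and the
    pulled-back functional on Z^N is nonzero at every unit vector, against [specker_finite]. *)
Lemma null_disjoint (F : nat -> I -> Prop) :
  (forall m n i, F m i -> F n i -> m = n) -> exists n, null (F n).
Proof.
move=> dF; apply: contrapT => nF.
have ex n : exists x : I -> int, (forall i, ~ F n i -> x i = 0) /\ phi x <> 0.
  apply: contrapT => nx; apply: nF; exists n => x xF; apply: contrapT => px.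
  by apply: nx; exists x.
have {ex} [x xP] := choice ex.
have [r rP] : {r : I -> nat & forall i n, F n i -> r i = n}.
  apply: (choice (P := fun i k => forall n, F n i -> k = n)) => i.
  have [[n Fni]|nFi] := EM (exists n, F n i).
    by exists n => m; exact: dF.
  by exists 0%N => n Fn; case: nFi; exists n.
pose X i := x (r i) i.
have hpsi := addf_comp r X hphi.
have [n /(_ n (leqnn n))] := specker_finite hpsi.
have -> : (fun i => unitv n (r i) * X i) = x n.
  apply: funext => i; have [<-|ne] := EM (r i = n); first by rewrite unitv_eq mul1r.
  by rewrite unitv_neq// mul0r (xP n).1// => /rP.
exact: (xP n).2.
Qed.

(** Sorting the coordinates of [x] by a set [F n] that contains them pulls [phi] back to a
    functional that vanishes at unit vectors, hence also at the constant vector 1, which recovers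
    [x]. *)
Lemma null_bigcup (F : nat -> I -> Prop) (S : I -> Prop) :
  (forall n, null (F n)) -> (forall i, S i -> exists n, F n i) -> null S.
Proof.
move=> nF SF; suff : null (fun i => exists n, F n i) by exact: null_sub.
move=> x xF.
have [r rP] : {r : I -> nat & forall i, (exists n, F n i) -> F (r i) i}.
  apply: (choice (P := fun i k => (exists n, F n i) -> F k i)) => i.
  have [[n Fni]|nFi] := EM (exists n, F n i); first by exists n.
  by exists 0%N => /nFi.
have -> : phi x = phi (fun i => (fun=> 1) (r i) * x i).
  by congr phi; apply: funext => i; rewrite mul1r.
apply: (specker_zero (addf_comp r x hphi) _ (fun=> 1)) => n; apply: (nF n) => i nFi.
have [e|ne] := EM (r i = n); last by rewrite unitv_neq// mul0r.
by rewrite xF ?mulr0// => /rP; rewrite e.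
Qed.

Definition atom (S : I -> Prop) : Prop := ~ null S /\
  forall A : I -> Prop, null (fun i => S i /\ A i) \/ null (fun i => S i /\ ~ A i).

(** Otherwise sets can be split forever into two parts that are not null; the parts split off are
    disjoint, against [null_disjoint]. *)
Lemma atom_ex (S : I -> Prop) : ~ null S ->
  exists S', (forall i, S' i -> S i) /\ atom S'.
Proof.
move=> S0; apply: contrapT => nat_.
pose pos := {S' : I -> Prop | ~ null S' /\ forall i, S' i -> S i}.
have split_ (S' : pos) : {A : I -> Prop | ~ null (fun i => sval S' i /\ A i) /\
    ~ null (fun i => sval S' i /\ ~ A i)}.
  apply: cid; case: S' => S' [S'0 SS] /=; apply: contrapT => nA; apply: nat_.
  exists S'; split => //; split => // A; apply: contrapT => /not_orP h.
  by apply: nA; exists A.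
pose step (S' : pos) : pos := exist _ (fun i => sval S' i /\ ~ sval (split_ S') i)
  (conj (svalP (split_ S')).2 (fun i (h : sval S' i /\ _) => (svalP S').2 i h.1)).
pose F := fix F n := if n is m.+1 then step (F m) else exist _ S (conj S0 (fun i h => h)) : pos.
have Fdec m n i : (m <= n)%N -> sval (F n) i -> sval (F m) i.
  elim: n => [|n IH]; first by rewrite leqn0 => /eqP ->.
  by rewrite leq_eqVlt => /orP[/eqP -> //|]; rewrite ltnS => /IH h [/h].
have [|n nF] := @null_disjoint (fun n i => sval (F n) i /\ sval (split_ (F n)) i).
  move=> m n i [Fm Am] [Fn An]; case: (ltngtP m n) => [mn|nm|//]; exfalso.
    by have [_] := Fdec _ _ _ mn Fn.
  by have [_] := Fdec _ _ _ nm Fm.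
exact: (svalP (split_ (F n))).1 nF.
Qed.

End Null.

Definition lin (I : Type) (w : seq (I * int)) (x : I -> int) : int :=
  \sum_(p <- w) p.2 * x p.1.

(* Los: a functional is carried by finitely many atoms, and an atom carries a
   countably complete ultrafilter. *)
Lemma addf_finite (I : Type) (phi : (I -> int) -> int)
  (hI : forall U : (I -> Prop) -> Prop, ccu U -> exists i, U (eq^~ i)) : addf phi ->
  exists w : seq (I * int),
    (forall i c, List.In (i, c) w -> phi (unitv i) <> 0) /\ phi = lin w.
Proof.
move=> hphi.
have atomP S : atom (phi := phi) S -> exists2 i, S i & phi (unitv i) <> 0.
  (* The sets whose complement in the atom is null form a countably complete ultrafilter, so by [hI]
     a single index carries it. *)
  move=> [S0 at_]; have [|i iS] := hI (fun A => null (phi := phi) (fun i => S i /\ ~ A i)).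
    split.
    - move=> A B AB; have [nA|nA] := at_ A; last by left.
      right; apply: null_sub nA => i [Si nB]; split=> //.
      by case: (AB i).
    - by move=> h; apply: S0; apply: null_sub h => i; split.
    - move=> F B hF FB; apply: (null_bigcup hphi hF) => i [Si nBi].
      apply: contrapT => nF; apply: nBi; apply: FB => n; apply: contrapT => nFn.
      by apply: nF; exists n.
  have [x [xS px]] : exists x : I -> int, (forall i, ~ S i -> x i = 0) /\ phi x <> 0.
    apply: contrapT => nx; apply: S0 => x xS; apply: contrapT => px.
    by apply: nx; exists x.
  have E : phi x = x i * phi (unitv i).
    rewrite (addfE hphi (x := fun j => x i * unitv i j)
      (y := fun j => if pselect (j = i) then 0 else x j)).
    - rewrite (addfM hphi) [X in _ + X]iS ?addr0// => j nj.
      case: pselect => // ji; apply: xS => Sj; exact: nj.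
    - move=> j; case: pselect => [e|ji] /=; first by rewrite e unitv_eq mulr1 addr0.
      by rewrite unitv_neq// mulr0 add0r.
  exists i.
    by apply: contrapT => /xS xi; apply: px; rewrite E xi mul0r.
  by move=> p0; apply: px; rewrite E p0 mulr0.
(* Infinitely many such indices would give disjoint singletons that are not null. *)
have [E EP] : exists E : seq I, forall i, phi (unitv i) <> 0 -> List.In i E.
  apply: contrapT => nE.
  have next (E : seq I) : {i | phi (unitv i) <> 0 /\ ~ List.In i E}.
    apply: cid; apply: contrapT => ni; apply: nE; exists E => i pi.
    by apply: contrapT => iE; apply: ni; exists i.
  pose L := fix L n := if n is m.+1 then sval (next (L m)) :: L m else [::].
  have Lin m n : (m < n)%N -> List.In (sval (next (L m))) (L n).
    elim: n => // n IH; rewrite ltnS leq_eqVlt => /orP[/eqP -> |/IH]; first by left.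
    by right.
  have [|n nF] := null_disjoint hphi (F := fun n i => i = sval (next (L n))).
    move=> m n i -> e; case: (ltngtP m n) => [mn|nm|//]; exfalso.
      by apply: (svalP (next (L n))).2; rewrite -e; exact: Lin.
    by apply: (svalP (next (L m))).2; rewrite e; exact: Lin.
  apply: (svalP (next (L n))).1; apply: nF => i ne; exact: unitv_neq.
have nE : null (phi := phi) (fun i => ~ List.In i E).
  apply: contrapT => /(atom_ex hphi)[S [SE /atomP[i Si pi]]].
  exact: SE Si (EP i pi).
have {EP nE} : forall x : I -> int, (forall i, List.In i E -> x i = 0) -> phi x = 0.
  by move=> x xE; apply: nE => i /contrapT; exact: xE.
(* One coordinate is cut off at a time; its coefficient [phi (unitv i)] is recorded only if
   nonzero. *)
elim: E phi hphi {atomP} => [|i E IH] phi hphi phiE.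
  exists [::]; split => //; apply: funext => x; rewrite /lin big_nil; exact: phiE.
pose cut (x : I -> int) j := if pselect (j = i) then 0 else x j.
have hcut : addf (fun x => phi (cut x)).
  move=> x y; apply: (addfE hphi) => j; by rewrite /cut; case: pselect => _ /=; rewrite ?addr0.
have phi_cut x : phi x = phi (unitv i) * x i + phi (cut x).
  rewrite mulrC -(addfM hphi); apply: (addfE hphi) => j; rewrite /cut.
  case: pselect => [e|ne] /=; first by rewrite e unitv_eq mulr1 addr0.
  by rewrite unitv_neq// mulr0 add0r.
have [|w [wP wE]] := IH _ hcut.
  move=> x xE; apply: phiE => j [<-|jE]; rewrite /cut; case: pselect => //= _.
  exact: xE.
have {}wP j c : List.In (j, c) w -> phi (unitv j) <> 0.
  move=> /wP; have [->|ji] := EM (j = i).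
    have -> : cut (unitv i) = fun=> 0.
      by apply: funext => k; rewrite /cut; case: pselect => //= ki; rewrite unitv_neq.
    by rewrite addf0.
  by rewrite (phi_cut (unitv j)) unitv_neq ?mulr0 ?add0r// => /esym.
have [pi|pi] := EM (phi (unitv i) = 0).
  exists w; split => //; rewrite -wE; apply: funext => x.
  by rewrite phi_cut pi mul0r add0r.
exists ((i, phi (unitv i)) :: w); split=> [j c [[<- _] //|]|]; first exact: wP.
by apply: funext => x; rewrite /lin big_cons phi_cut -/(lin w x) -wE.
Qed.

(** * Closed subgroups with countable support *)

Lemma countable_infinite_enum (T : Type) (A : set T) : countable A -> infinite_set A ->
  exists (e : nat -> T) (pos : T -> nat),
    [/\ forall n, A (e n), forall n, pos (e n) = n & forall x, A x -> e (pos x) = x].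
Proof.
move=> cA /infiniteP iA; have : (A #= [set: nat])%card by rewrite card_eq_le; apply/andP.
move=> /card_set_bijP[pos [_ inj surj]].
have [e eP] : {e : nat -> T & forall n, A (e n) /\ pos (e n) = n}.
  by apply: (choice (P := fun n x => A x /\ pos x = n)) => n; have [x Ax <-] := surj n I; exists x.
exists e, pos; split=> [n|n|x Ax]; [exact: (eP n).1|exact: (eP n).2|].
by apply: inj; rewrite ?inE//; [exact: (eP _).1|exact: (eP _).2].
Qed.

Lemma countable_setU (T : Type) (A B : set T) :
  countable A -> countable B -> countable (A `|` B).
Proof.
move=> cA cB; rewrite (_ : A `|` B = \bigcup_(b in [set: bool]) if b then A else B).
  by apply: bigcup_countable => [|[]]; rewrite ?countableP.
apply/seteqP; split=> [x [xA|xB]|x [[] _ xb]]; [by exists true|by exists false|by left|by right].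
Qed.

Lemma infinite_set_seq (T : Type) (A : set T) : infinite_set A ->
  exists g : nat -> T, injective g /\ forall n, A (g n).
Proof.
move=> /infiniteP/card_leP[f]; exists (fun n => val (f (to_setT n))).
split=> [m n /val_inj|n]; last exact: set_valP.
have /= := @inj _ _ _ f (to_setT m) (to_setT n); rewrite !inE => h /h.
by move=> /(_ I I)/(congr1 val).
Qed.

(** The class of [x] is nonzero in a product, so one of its coordinates is nonzero; that coordinate
    of the quotient map is [phi]. *)
Lemma product_quot_separated (I : small) (A : zmodClosed (I -> int)) (x : I -> int) :
  is_product {quot A} -> x \notin A ->
  exists phi, [/\ addf phi, forall y, y \in A -> phi y = 0 & phi x <> 0].
Proof.
move=> [J [f bf]] xA; apply: contrapT => nphi.
have f0 : f (\pi_{quot A} x) = 0.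
  apply: funext => j; apply: contrapT => fj; apply: nphi.
  exists (fun y => f (\pi_{quot A} y) j); split => // [y z|y yA].
    by rewrite !raddfD.
  have -> : \pi_{quot A} y = 0.
    by apply/eqP; rewrite -(raddf0 \pi_{quot A}) -idealrBE subr0.
  by rewrite raddf0.
have /eqP : \pi_{quot A} x = 0 by apply: (bij_inj bf); rewrite f0 raddf0.
by rewrite -(raddf0 \pi_{quot A}) -idealrBE subr0 (negbTE xA).
Qed.

Lemma lin_congr (I : Type) (w : seq (I * int)) (x y : I -> int) :
  (forall i c, List.In (i, c) w -> x i = y i) -> lin w x = lin w y.
Proof.
rewrite /lin; elim: w => [|[i c] w IH] xy; first by rewrite !big_nil.
rewrite !big_cons /= (xy i c); last by left.
by rewrite IH// => j d jd; apply: (xy j d); right.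
Qed.

Lemma addf_lin (I : Type) (w : seq (I * int)) : addf (lin w).
Proof. by move=> x y; rewrite /lin -big_split; apply: eq_bigr => p _ /=; rewrite -mulrDr. Qed.

Lemma lin0 (I : Type) (w : seq (I * int)) (x : I -> int) :
  (forall i c, List.In (i, c) w -> x i = 0) -> lin w x = 0.
Proof. by move=> /lin_congr ->; exact: addf0 (addf_lin w). Qed.

Lemma memM (I : Type) (A : zmodClosed (I -> int)) (c : int) (x : I -> int) :
  x \in A -> (fun i => c * x i) \in A.
Proof.
move=> xA; have H (n : nat) : (fun i => n%:Z * x i) \in A.
  elim: n => [|n IH].
    rewrite (_ : (fun _ => _) = 0) ?rpred0//; apply: funext => i; exact: mul0r.
  rewrite (_ : (fun _ => _) = (fun i => n%:Z * x i) + x) ?rpredD//.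
  by apply: funext => i; rewrite -addn1 PoszD mulrDl mul1r.
case: c => n //; rewrite (_ : (fun _ => _) = - (fun i => n.+1%:Z * x i)) ?rpredN//.
by apply: funext => i; rewrite NegzE mulNr.
Qed.

Lemma memB (I : Type) (A : zmodClosed (I -> int)) (x y : I -> int) (c : int) :
  x \in A -> y \in A -> (fun i => x i - c * y i) \in A.
Proof.
move=> xA yA; rewrite (_ : (fun _ => _) = x - (fun i => c * y i)) //.
by rewrite rpredB// memM.
Qed.

Lemma memS (I : Type) (A : zmodClosed (I -> int)) (a : nat -> I -> int) (c : nat -> int) K :
  (forall n, a n \in A) -> (fun i => \sum_(n < K) c n * a n i) \in A.
Proof.
move=> aA; elim: K => [|K IH].
  rewrite (_ : (fun _ => _) = 0) ?rpred0//; apply: funext => i; exact: big_ord0.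
rewrite (_ : (fun _ => _) =
  (fun i => \sum_(n < K) c n * a n i) + (fun i => c K * a K i)).
  by rewrite rpredD// memM.
by apply: funext => i; rewrite big_ord_recr.
Qed.

Lemma sum_ord_trunc (F : nat -> int) k K : (k < K)%N ->
  (forall n, (k < n)%N -> F n = 0) -> \sum_(n < K) F n = \sum_(n < k.+1) F n.
Proof.
move=> + F0; elim: K => // K IH; rewrite ltnS leq_eqVlt => /orP[/eqP -> //|kK].
by rewrite big_ord_recr /= F0// addr0 IH.
Qed.

(* Gaussian elimination: [a n] generates the leading coefficients at [e n]. *)
Lemma leading_generator (I : Type) (A : zmodClosed (I -> int)) (e : nat -> I) (n : nat) :
  exists a : I -> int, [/\ a \in A, forall k, (k < n)%N -> a (e k) = 0,
    a (e n) = 0 -> a = 0 &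
    forall b, b \in A -> (forall k, (k < n)%N -> b (e k) = 0) ->
      exists q, b (e n) = q * a (e n)].
Proof.
pose lead b := b \in A /\ forall k, (k < n)%N -> b (e k) = 0.
pose Q m := `[< exists b, [/\ lead b, b (e n) <> 0 & `|b (e n)|%N = m] >].
have [exQ|nQ] := EM (exists m, Q m); last first.
  exists 0; split=> // [|b bA bk]; first exact: rpred0.
  exists 0; rewrite mul0r; apply: contrapT => bn; apply: nQ.
  by exists `|b (e n)|%N; apply/asboolP; exists b.
case: (ex_minnP exQ) => m /asboolP[a [[aA ak] an <-]] min.
exists a; split=> // b bA bk; exists (b (e n) %/ a (e n))%Z.
rewrite {1}(divz_eq (b (e n)) (a (e n))); set r := (_ %% _)%Z.
suff -> : r = 0 by rewrite addr0.
apply: contrapT => r0.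
pose q := (b (e n) %/ a (e n))%Z.
have rE : b (e n) - q * a (e n) = r by rewrite {1}(divz_eq (b (e n)) (a (e n))) addrC addKr.
have : Q `|r|%N.
  apply/asboolP; exists (fun i => b i - q * a i); rewrite rE; split => //; split.
    exact: memB.
  by move=> k kn; rewrite bk// ak// mulr0 subr0.
move=> /min; apply/negP; rewrite -ltnNge -ltz_nat gez0_abs ?modz_ge0//; last exact/eqP.
by rewrite ltz_mod//; exact/eqP.
Qed.

(** [A] contains every vector that vanishes on [S], so only countably many coordinates are
    constrained. Along these an echelon family serves as an infinite basis. *)
Lemma closed_countable_support_iso (I : small) (A : zmodClosed (I -> int)) (S : set I) :
  ~ countable [set: I] -> countable S ->
  (forall x, x \notin A -> exists w : seq (I * int),
    [/\ forall i c, List.In (i, c) w -> S i, forall y, y \in A -> lin w y = 0 & lin w x <> 0]) ->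
  isomorphic (subgroup A) (I -> int).
Proof.
move=> ucI cS clA.
have SA x : (forall i, S i -> x i = 0) -> x \in A.
  move=> xS; apply: contrapT => /negP/clA[w [wS _]]; apply; apply: lin0 => i c /wS; exact: xS.
(* Infinitely many coordinates outside [S] are added; their unit vectors lie in [A], which makes the
   set of pivots infinite. *)
have [g [g_inj gS]] : exists g : nat -> I, injective g /\ forall n, (~` S) (g n).
  apply: infinite_set_seq => fS; apply: ucI; rewrite -(setUv S).
  by apply: countable_setU => //; exact: finite_set_countable.
pose S2 := S `|` range g.
have SS2 i : S i -> S2 i by left.
have ig : infinite_set (range g).
  apply/infiniteP; apply: (@card_le_trans _ _ _ (range g)) => //.
  by have := inj_card_eq (A := setT) (f := g) (in2W g_inj); rewrite card_eq_le => /andP[].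
have [||e [pos [eS2 posK eK]]] := @countable_infinite_enum _ S2.
- by apply: countable_setU => //; apply: card_le_trans (card_image_le _ _) _; exact: countableP.
- by apply: sub_infinite_set ig => x; right.
have [a aP] := choice (leading_generator A e).
have aA n : a n \in A by case: (aP n).
have alead n k : (k < n)%N -> a n (e k) = 0 by case: (aP n) => _ + _ _; exact.
have a0 n : a n (e n) = 0 -> a n = 0 by case: (aP n).
have adiv n b : b \in A -> (forall k, (k < n)%N -> b (e k) = 0) ->
    exists q, b (e n) = q * a n (e n) by case: (aP n) => _ _ _; exact.
have [|nu [mu [nuN nuK muK]]] := @countable_infinite_enum _ [set n | a n (e n) <> 0] (countableP _).
  move=> fN; apply: ig; apply: sub_finite_set (finite_image e fN) => i [n _ gn].
  have iS2 : S2 i by right; exists n.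
  exists (pos i); last exact: eK.
  move=> /= ai; have [|j jS|q] := adiv (pos i) (unitv i).
  + by apply: SA => j Sj; apply: unitv_neq => ji; apply: (gS n); rewrite gn -ji.
  + apply: unitv_neq => ji; move: jS; rewrite -ji posK ltnn //.
  + by rewrite ai mulr0 eK// unitv_eq.
(* On [S2] this is the infinite combination of the [a n], with [mu] numbering the pivots. The sum
   stops at [pos i] because [a n] vanishes at [e k] for k < n. *)
pose theta (y : I -> int) i :=
  if pselect (S2 i) then \sum_(n < (pos i).+1) y (e (mu n)) * a n i else y i.
have thetaA y : theta y \in A.
  (* A separating functional sees finitely many coordinates, on which [theta y] agrees with a finite
     combination of the [a n]. *)
  apply: contrapT => /negP/clA[w [wS wA]]; apply.
  have [K KP] : exists K, forall i c, List.In (i, c) w -> (pos i < K)%N.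
    elim: (w) => [|[i c] w' [K KP]]; first by exists 0%N.
    exists (maxn K (pos i).+1) => j d [[<- _]|/KP h]; first by rewrite leq_max leqnn orbT.
    by rewrite leq_max h.
  rewrite -(wA _ (memS (fun n => y (e (mu n))) K aA)); apply: lin_congr => i c ic.
  have iS2 := SS2 _ (wS _ _ ic); rewrite /theta; case: pselect => //= _.
  apply/esym; apply: (sum_ord_trunc (F := fun n => y (e (mu n)) * a n i)); first exact: KP ic.
  by move=> n; rewrite -{2}(eK i iS2) => /alead ->; rewrite mulr0.
have thetaB x y : theta (x - y) = theta x - theta y.
  apply: funext => i; change (theta (x - y) i = theta x i - theta y i).
  rewrite /theta; case: pselect => //= _.
  apply/esym; rewrite -sumrB; apply: eq_bigr => n _; exact/esym/mulrBl.
have theta0 y : theta y = 0 -> y = 0.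
  move=> ty; have ty0 i : theta y i = 0 by rewrite ty.
  have H n : a n (e n) <> 0 -> y (e (mu n)) = 0.
    elim/ltn_ind: n => n IH an; have := ty0 (e n).
    rewrite /theta; case: pselect => //= _; rewrite posK big_ord_recr /= big1 => [|k _].
      by rewrite add0r => /eqP; rewrite mulf_eq0 => /orP[/eqP|/eqP].
    have [/a0 ->|/(IH k (ltn_ord k)) ->] := EM (a k (e k) = 0); first exact: mulr0.
    exact: mul0r.
  apply: funext => i; have := ty0 i; rewrite /theta; case: pselect => //= iS2 _.
  by rewrite -(eK i iS2) -(nuK (pos i)) H//; exact: nuN.
have theta_surj x : x \in A -> exists y, theta y = x.
  move=> xA; pose b i := if pselect (S2 i) then x i else 0.
  have bA : b \in A.
    rewrite (_ : b = x - (fun i => if pselect (S2 i) then 0 else x i)).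
      by rewrite rpredB//; apply: SA => i /SS2 iS2; case: pselect.
    apply: funext => i; change (b i = x i - (if pselect (S2 i) then 0 else x i)).
    by rewrite /b; case: pselect => _ /=; rewrite ?subr0 ?subrr.
  have [Q QP] : {Q : nat * (I -> int) -> int & forall p, p.2 \in A ->
      (forall k, (k < p.1)%N -> p.2 (e k) = 0) -> p.2 (e p.1) = Q p * a p.1 (e p.1)}.
    apply: (choice (P := fun p q => p.2 \in A ->
      (forall k, (k < p.1)%N -> p.2 (e k) = 0) -> p.2 (e p.1) = q * a p.1 (e p.1))) => -[n f] /=.
    have [[fA fk]|nf] := EM (f \in A /\ forall k, (k < n)%N -> f (e k) = 0).
      by have [q qP] := adiv n f fA fk; exists q.
    by exists 0 => fA fk; case: nf.
  (* [r m] is what remains of [b] once its first [m] coordinates along [e] are cleared. *)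
  pose r := fix r m : I -> int := if m is k.+1 then fun i => r k i - Q (k, r k) * a k i else b.
  have rP m : r m \in A /\ forall k, (k < m)%N -> r m (e k) = 0.
    elim: m => [|m [rA rk]]; first by split.
    split=> [|k]; first exact: memB.
    rewrite ltnS leq_eqVlt /= => /orP[/eqP ->|km].
      by have /= -> := QP (m, r m) rA rk; rewrite subrr.
    by rewrite rk// alead// mulr0 subr0.
  have bE K i : b i = \sum_(n < K) Q (val n, r n) * a n i + r K i.
    elim: K => [|K IH]; first by rewrite big_ord0 add0r.
    by rewrite big_ord_recr /= -addrA [X in _ + X]addrC subrK.
  exists (fun i => if pselect (S2 i) then Q (nu (pos i), r (nu (pos i))) else x i).
  apply: funext => i; rewrite /theta; case: pselect => //= iS2.
  have -> : x i = b i by rewrite /b; case: pselect.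
  have r0 : r (pos i).+1 i = 0 by rewrite -[X in r _ X](eK i iS2) (rP _).2.
  rewrite (bE (pos i).+1 i) r0 addr0.
  apply: eq_bigr => n _; have [/a0 ->|an] := EM (a n (e n) = 0); first by rewrite !mulr0.
  by case: pselect => [_|] /=; [rewrite posK muK|case; exact: eS2].
have [f fP] : {f : subgroup A -> I -> int & forall s, theta (f s) = val s}.
  apply: (choice (P := fun (s : subgroup A) y => theta y = val s)) => s.
  by apply: theta_surj; exact: valP.
have theta_inj x y : theta x = theta y -> x = y.
  by move=> xy; apply/eqP; rewrite -subr_eq0; apply/eqP/theta0; rewrite thetaB xy subrr.
have fB : zmod_morphism f.
  by move=> s t; apply: theta_inj; rewrite thetaB !fP raddfB.
pose fM := GRing.isZmodMorphism.Build _ _ f fB.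
pose F : {additive subgroup A -> (I -> int)} := HB.pack f fM.
exists F; exists (fun y => Subgroup (thetaA y)) => [s|y].
  by apply: val_inj => /=; exact: fP.
by apply: theta_inj; rewrite [LHS]fP.
Qed.

(** * Bounded families in a well-order *)

Section Bounded.
Context {D : Type} {R : rel D} (wo : well_order R).

(* That a family indexed by finite sequences in [X] cannot be cofinal if no family
   indexed by [X] is replaces the equality of the cardinals of [X] and [seq X]. *)
Definition bounded (X : Type) : Prop := forall b : X -> D, exists d, forall x, R (b x) d.

Lemma bounded_surj (X Y : Type) (f : X -> Y) : (forall y, exists x, f x = y) ->
  bounded X -> bounded Y.
Proof.
move=> sf bX b; have [d bd] := bX (fun x => b (f x)).
by exists d => y; have [x <-] := sf y.
Qed.

Lemma bounded_prod (X Y : Type) : bounded X -> bounded Y -> bounded (X * Y).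
Proof.
move=> bX bY b; have [c cP] := choice (fun x => bY (fun y => b (x, y))).
have [d dP] := bX c; exists d => -[x y]; exact: (wo_trans wo) (cP x y) (dP x).
Qed.

(** Bounds are found for each length by induction, and then over all lengths, for which [nat] must
    be bounded. *)
Lemma bounded_seq (X : Type) : bounded nat -> bounded X -> bounded (seq X).
Proof.
move=> bN bX b.
have len n : forall b : seq X -> D, exists d, forall s, size s = n -> R (b s) d.
  elim: n => [|n IH] {}b.
    by exists (b [::]) => -[|//] _; exact: wo_refl.
  have [c cP] := choice (fun x => IH (fun s => b (x :: s))).
  have [d dP] := bX c; exists d => -[//|x s] [sn].
  exact: (wo_trans wo) (cP x s sn) (dP x).
have [c cP] := choice (fun n => len n b); have [d dP] := bN c.
by exists d => s; exact: (wo_trans wo) (cP _ s erefl) (dP _).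
Qed.

End Bounded.

Arguments bounded {D} R X.

(** * Functionals with large independent supports *)

Lemma In_support (I : Type) (w : seq (I * int)) i :
  lin w (unitv i) <> 0 -> List.In i (map fst w).
Proof.
move=> wi; apply: contrapT => ni; apply: wi; apply: lin0 => j c jc.
apply: unitv_neq => ji; apply: ni; rewrite -ji.
by elim: w jc => //= p w IH [->|/IH]; [left|right].
Qed.

Lemma In_map_fst (I : Type) (w : seq (I * int)) i c :
  List.In (i, c) w -> List.In i (map fst w).
Proof. by elim: w => //= p w IH [->|/IH]; [left|right]. Qed.

(** The values of [x] at the pivots [p y] are chosen by recursion. At stage [y] the earlier pivots
    are settled and later ones do not occur in [w y], so the value at [p y] can prevent
    vanishing. *)
Lemma triangular_nonvanishing (I : Type) (R : rel I) (P : I -> Prop)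
    (w : I -> seq (I * int)) (p : I -> I) : well_order R ->
  (forall y, P y -> lin (w y) (unitv (p y)) <> 0) ->
  (forall y z, P y -> strictly R z y -> ~ List.In (p y) (map fst (w z))) ->
  exists x, forall y, P y -> lin (w y) x <> 0.
Proof.
move=> wo wp wz.
have p_inj y z : P y -> P z -> p y = p z -> y = z.
  move=> Py Pz e; apply: contrapT => ne.
  have [yz|zy] := wo_total wo y z.
    by apply: (wz z y) => //; rewrite -e; apply: In_support; exact: wp.
  apply: (wz y z) => //; first by split => // /esym.
  by rewrite e; apply: In_support; exact: wp.
pose below y (v : I -> int) i : int :=
  if pselect (exists z, [/\ P z, strictly R z y & p z = i]) is left h
  then v (sval (cid h)) else 0.
have belowE y v z : P z -> strictly R z y -> below y v (p z) = v z.
  move=> Pz zy; rewrite /below; case: pselect => [h|]; last by case; exists z.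
  by case: cid => u /= [Pu _ /p_inj ->].
have below0 y v i : ~ (exists z, [/\ P z, strictly R z y & p z = i]) -> below y v i = 0.
  by rewrite /below; case: pselect.
have below_congr y v v' : (forall z, strictly R z y -> v z = v' z) -> below y v = below y v'.
  move=> vv; apply: funext => i; rewrite /below; case: pselect => // h.
  by case: cid => u /= [_ uy _]; exact: vv.
have [|v vP] := wf_choice 0 (Q := fun y h t => P y ->
    lin (w y) (fun i => below y h i + t * unitv (p y) i) <> 0) (wo_wf wo).
  move=> y h; have [Py|nPy] := EM (P y); last by exists 0.
  have E t : lin (w y) (fun i => below y h i + t * unitv (p y) i) =
      lin (w y) (below y h) + t * lin (w y) (unitv (p y)).
    by rewrite -(addfM (addf_lin _)); exact: (addfE (addf_lin _)).
  (* The coefficient at [p y] is nonzero, so one of the values 1 and 0 works. *)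
  have [b0|b0] := EM (lin (w y) (below y h) = 0).
    by exists 1 => _; rewrite E b0 add0r mul1r; exact: wp.
  by exists 0 => _; rewrite E mul0r addr0.
pose x i : int := if pselect (exists z, P z /\ p z = i) is left h then v (sval (cid h)) else 0.
have xE z : P z -> x (p z) = v z.
  move=> Pz; rewrite /x; case: pselect => [h|]; last by case; exists z.
  by case: cid => u /= [Pu /p_inj ->].
have x0 i : ~ (exists z, P z /\ p z = i) -> x i = 0 by rewrite /x; case: pselect.
exists x => y Py; have := vP y Py.
rewrite (below_congr _ _ v); last by move=> z zy; case: pselect.
congr (_ <> _); apply: lin_congr => i c ic.
have [[z [Pz zi]]|nz] := EM (exists z, P z /\ p z = i); last first.
  rewrite x0// below0; last by move=> [z [Pz _ zi]]; apply: nz; exists z.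
  by rewrite unitv_neq ?mulr0 ?addr0// => iy; apply: nz; exists y.
rewrite -zi in ic *; rewrite xE//; have [zy|yz] := EM (strictly R z y).
  rewrite belowE// unitv_neq ?mulr0 ?addr0// => /p_inj e.
  by case: zy => _; apply; exact: e.
have [e|ne] := EM (z = y).
  rewrite e unitv_eq mulr1 below0 ?add0r// => -[u [Pu uy /p_inj pu]].
  by case: uy => _; apply; exact: pu.
have yz' : strictly R y z by apply/(wo_lt_le wo) => zy; apply: yz.
by case: (wz z y Pz yz'); exact: In_map_fst ic.
Qed.

(* [P] is the least initial segment of [I] indexing finite sets that cover the
   coordinates of some [B d]; it is uncountable, and it indexes a cofinal family. *)
Lemma long_chain_functional (I D : small) (R : rel D) (B : D -> set ((I -> int) -> int)) :
  well_order R ->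
  (forall d d', R d d' -> B d' `<=` B d) ->
  (forall d phi, B d phi -> exists w, phi = lin w /\
     forall i c, List.In (i, c) w -> phi (unitv i) <> 0) ->
  (forall d phi, B d phi -> phi <> (fun=> 0) -> exists d', ~ B d' phi) ->
  (forall d (S : set I), countable S ->
    exists phi i, [/\ B d phi, phi (unitv i) <> 0 & ~ S i]) ->
  D ->
  exists x : I -> int, forall d, exists2 d', R d d' & exists2 phi, B d' phi & phi x <> 0.
Proof.
move=> wo Bdec Bfin Bcap Bbig d0.
have [RI woI] := well_ordering_principle {classic I}.
pose lt : I -> I -> Prop := strictly RI.
pose supports (P : I -> Prop) := exists d (e : I -> seq I), forall phi, B d phi ->
  forall i, phi (unitv i) <> 0 -> exists z, P z /\ List.In i (e z).
have [P [supP minP Plt]] : exists P, [/\ supports P,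
    forall y, P y -> ~ supports (lt^~ y) & forall y z, P y -> lt z y -> P z].
  have [[y0 y0P]|ny] := EM (exists y, supports (lt^~ y)).
    have [|y [yP ymin]] := @wo_min _ _ woI (fun y => supports (lt^~ y)); first by exists y0.
    exists (lt^~ y); split=> // [z zy /ymin|z u]; last first.
      by move=> zy uz; exact: (wo_lt_trans woI) uz zy.
    exact/(wo_lt_le woI).
  exists (fun=> True); split=> // [|y _ yP]; last by apply: ny; exists y.
  by exists d0, (fun i => [:: i]) => phi _ i _; exists i; split => //; left.
have [dP [e eP]] := supP.
have uncP : ~ countable [set z | P z].
  move=> cP; pose S := \bigcup_(z in [set z | P z]) [set i | List.In i (e z)].
  have cS : countable S.
    apply: bigcup_countable => // z _; apply: finite_set_countable.
    elim: (e z) => [|j s IH]; first by rewrite (_ : [set _ | _] = set0)//; apply/seteqP; split.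
    rewrite (_ : [set _ | _] = [set j] `|` [set i | List.In i s]).
      by rewrite finite_setU; split => //; exact: finite_set1.
    by apply/seteqP; split=> i /= [->|?]; [left|right|left|right].
  have [phi [i [Bphi pi nS]]] := Bbig dP S cS.
  by have [z [Pz iz]] := eP _ Bphi _ pi; apply: nS; exists z.
pose X := {z | P z}.
(* Otherwise the stages at which functionals leave the chain are bounded, and beyond a bound only 0
   is left, against [Bbig]. *)
have unbounded : ~ bounded R X.
  move=> bX.
  have bN : bounded R nat.
    have [|g [g_inj gP]] := @infinite_set_seq _ [set z | P z].
      by move=> /finite_set_countable.
    have [h hK] : {h : I -> nat & forall n, h (g n) = n}.
      have [h hP] : {h : I -> nat & forall i n, g n = i -> h i = n}.
        apply: (choice (P := fun i k => forall n, g n = i -> k = n)) => i.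
        have [[n <-]|ni] := EM (exists n, g n = i); first by exists n => m /g_inj.
        by exists 0%N => n gn; case: ni; exists n.
      by exists h => n; exact: hP.
    apply: (bounded_surj (f := fun z : X => h (sval z)) _ bX) => n.
    by exists (exist _ (g n) (gP n)); exact: hK.
  have bZ : bounded R int.
    apply: (bounded_surj (f := fun n : nat => odflt 0 (unpickle n)) _ bN) => z.
    by exists (pickle z); rewrite pickleK.
  (* A coordinate is coded by an index in [X] and a position in the finite list that [e] attaches to
     it. *)
  pose code (w : seq (X * (nat * int))) : seq (I * int) :=
    map (fun p => (List.nth p.2.1 (e (sval p.1)) (sval p.1), p.2.2)) w.
  have [b bP] : {b : seq (X * (nat * int)) -> D & forall w,
      (exists d, ~ B d (lin (code w))) -> ~ B (b w) (lin (code w))}.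
    apply: (choice (P := fun w d => (exists d, ~ B d (lin (code w))) -> ~ B d (lin (code w)))) => w.
    have [[d dB]|nd] := EM (exists d, ~ B d (lin (code w))); first by exists d.
    by exists d0 => /nd.
  have [d dB] := bounded_seq wo bN (bounded_prod wo bX (bounded_prod wo bN bZ)) b.
  have [m [dm dPm]] : exists m, R d m /\ R dP m.
    by case: (wo_total wo d dP) => h; [exists dP|exists d]; split => //; exact: wo_refl.
  have [phi [i [Bphi pi _]]] := Bbig m set0 (countable0 _).
  have [w [phiE wP]] := Bfin _ _ Bphi.
  have [u uE] : exists u, code u = w.
    have : forall i c, List.In (i, c) w -> exists z, P z /\ List.In i (e z).
      by move=> j c /wP; apply: eP; exact: Bdec dPm _ Bphi.
    elim: w {phiE wP} => [|[j c] w IH] wP; first by exists [::].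
    have [|u <-] := IH; first by move=> k f kf; apply: (wP k f); right.
    have [|z [Pz /(List.In_nth _ _ z)[n [_ nj]]]] := wP j c; first by left.
    by exists ((exist _ z Pz, (n, c)) :: u); rewrite /= nj.
  rewrite -uE in phiE.
  have [|d' nBd'] := Bcap _ _ Bphi; first by move=> p0; apply: pi; rewrite p0.
  apply: (bP u); first by exists d'; rewrite -phiE.
  by rewrite -phiE; apply: Bdec _ Bphi; exact: (wo_trans wo) (dB u) dm.
have [b bP] : exists b : I -> D, forall d, exists2 z, P z & ~ R (b z) d.
  apply: contrapT => nb; apply: unbounded => b; apply: contrapT => nd; apply: nb.
  exists (fun z => if pselect (P z) is left h then b (exist _ z h) else d0) => d.
  apply: contrapT => nz; apply: nd; exists d => -[z Pz]; apply: contrapT => nR.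
  apply: nz; exists z => //; case: pselect => // h; congr (~ R (b _) d): nR.
  exact: eq_exist.
have [z0 _ _] := bP d0.
have [|g gP] := wf_choice ([::], z0) (Q := fun y h t => P y -> [/\ B (b y) (lin t.1),
    lin t.1 (unitv t.2) <> 0 & forall z, lt z y -> ~ List.In t.2 (map fst (h z).1)])
    (wo_wf woI : well_founded lt).
  move=> y h; have [Py|nPy] := EM (P y); last by exists ([::], z0).
  (* If every coordinate had been used before, the supports chosen below [y] would cover those of
     [B (b y)], against the minimality of [P]. *)
  apply: contrapT => nt; apply: (minP y Py); exists (b y), (fun z => map fst (h z).1).
  move=> phi Bphi i pi; apply: contrapT => nz; apply: nt.
  have [w [phiE _]] := Bfin _ _ Bphi; exists (w, i) => _; split => /=.
  - by rewrite -phiE.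
  - by rewrite -phiE.
  - by move=> z zy iz; apply: nz; exists z.
have [|y z Py zy|x xP] := @triangular_nonvanishing I RI P (fun y => (g y).1) (fun y => (g y).2) woI.
- by move=> y /gP[].
- have [_ _ /(_ z zy)] := gP y Py; case: pselect => //.
exists x => d; have [z Pz nR] := bP d; exists (b z).
  by have [|] := wo_total wo d (b z).
by exists (lin (g z).1); [case: (gP z Pz)|exact: xP].
Qed.

Local Close Scope ring_scope.
Local Close Scope quotient_scope.

(* [I] is a set of cardinality kappa, and [D], well-ordered by [leD], has order
   type delta. *)
Theorem theorem1p7
  (VL : V_eq_L)
  (I : small) (uncountable_I : ~ countable [set: I])
  (D : small) (leD : rel D) (wo_leD : well_order leD)
  (A : D -> zmodClosed (I -> int))
  (asc_A : ascending leD (fun a => [set` A a]))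
  (cont_A : continuous_chain leD (fun a => [set` A a]))
  (A_not_iso : forall a : D, ~ isomorphic (subgroup (A a)) (I -> int))
  (quot_A_product : forall a : D, is_product {quot A a}) :
  [set: I -> int] <> \bigcup_(a in [set: D]) [set` A a].
Proof.
move=> cover.
have inA x : exists a, x \in A a.
  have : [set: I -> int] x by [].
  by rewrite cover => -[a _ xa]; exists a.
have fin phi : addf phi -> exists w : seq (I * int),
    (forall i c, List.In (i, c) w -> phi (unitv i) <> 0%R) /\ phi = lin w.
  by apply: addf_finite => U; exact: V_eq_L_ccu_principal.
have [d0 _] := inA 0%R.
pose B d : set ((I -> int) -> int) := [set phi | addf phi /\ forall x, x \in A d -> phi x = 0%R].
have [||||x xP] := @long_chain_functional I D leD B wo_leD _ _ _ _ d0.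
- by move=> d d' dd' phi [aphi phiA]; split=> // y /(asc_A _ _ dd')/phiA.
- by move=> d phi [/fin[w [wP phiE]] _]; exists w.
(* A functional in every [B a] vanishes on the union of the [A a], which is everything. *)
- move=> d phi _ phi0; apply: contrapT => nd; apply: phi0; apply: funext => y.
  have [a ya] := inA y; apply: contrapT => py; apply: nd.
  by exists a => -[_ /(_ _ ya)].
(* If [S] contained all coordinates involved in [B d], then [A d], the common kernel of [B d], would
   be isomorphic to Z^I. *)
- move=> d S cS; apply: contrapT => nphi; apply: (A_not_iso d).
  apply: (closed_countable_support_iso uncountable_I cS) => y yA.
  have [phi [aphi phiA py]] := product_quot_separated (quot_A_product d) yA.
  have [w [wP phiE]] := fin _ aphi; rewrite phiE in phiA py.
  exists w; split=> // i c ic; apply: contrapT => Si; apply: nphi.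
  by exists phi, i; split=> //; [split=> // z; rewrite phiE; exact: phiA|exact: wP ic].
have [d xd] := inA x; have [d' dd' [phi [_ phiA] px]] := xP d.
exact: px (phiA _ (asc_A _ _ dd' _ xd)).
Qed.
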